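(* Let $\Omega\subset\mathbb{R}^N$ be a bounded domain with smooth boundary, $\omega\subset\Omega$ a nonempty open subset, $K>0$, $y_0\in L^2(\Omega)$, $T>0$, and, for $\varepsilon>0$ small, let $T_\varepsilon>0$, $a\in L^\infty(\Omega)$ and $a_\varepsilon\in L^\infty(\Omega)$. Assume: (1) $\|a_\varepsilon-a\|_{L^\infty(\Omega)}\to0$ as $\varepsilon\to0^+$; (2) $|T_\varepsilon-T|\to0$ as $\varepsilon\to0^+$; (3) $y(T;y_0)\notin\overline{B_K(0)}$, i.e. $\|y(T;y_0)\|_{\Omega}>K$. Fix $\delta\in(0,T)$ and let $\varepsilon_0>0$ be such that for every $\varepsilon\in(0,\varepsilon_0]$ one has $|T-T_\varepsilon|\le\delta$ and the minimizer of $J^{T_\varepsilon}_\varepsilon$ over $L^2(\Omega)$ is non-zero. Let $\hat\varphi_T$ and $\hat\varphi^\varepsilon_{T_\varepsilon}$, with $\varepsilon\in(0,\varepsilon_0]$, be the (non-zero) minimizers over $L^2(\Omega)$ of $J^T$ and $J^{T_\varepsilon}_\varepsilon$ respectively. Then $\hat\varphi^\varepsilon_{T_\varepsilon}\to\hat\varphi_T$ strongly in $L^2(\Omega)$ as $\varepsilon\to0^+$.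
   Context: $\|\cdot\|_\Omega,\langle\cdot,\cdot\rangle_\Omega$ are the norm and inner product of $L^2(\Omega)$, $\|\cdot\|_\omega$ is the norm of $L^2(\omega)$, and $\overline{B_K(0)}$ is the closed ball of radius $K$ centered at $0$ in $L^2(\Omega)$. $y(\cdot;y_0)$ is the solution of the uncontrolled equation $y_t-\Delta y-ay=0$ in $\Omega\times\mathbb{R}^+$, $y=0$ on $\partial\Omega\times\mathbb{R}^+$, $y(0)=y_0$. For $\varphi_T\in L^2(\Omega)$, $\varphi(\cdot;\varphi_T,T)$ is the solution of $\varphi_t+\Delta\varphi+a\varphi=0$ in $\Omega\times(0,T)$, $\varphi=0$ on $\partial\Omega\times(0,T)$, $\varphi(T)=\varphi_T$; and for $\psi\in L^2(\Omega)$, $\varphi^\varepsilon(\cdot;\psi,T_\varepsilon)$ is the solution of $\varphi^\varepsilon_t+\Delta\varphi^\varepsilon+a_\varepsilon\varphi^\varepsilon=0$ in $\Omega\times(0,T_\varepsilon)$, $\varphi^\varepsilon=0$ on $\partial\Omega\times(0,T_\varepsilon)$, $\varphi^\varepsilon(T_\varepsilon)=\psi$. The functionals on $L^2(\Omega)$ are $$J^T(\varphi_T)=\frac12\Big(\int_0^T\|\varphi(t;\varphi_T,T)\|_\omega\,dt\Big)^2+\langle y_0,\varphi(0;\varphi_T,T)\rangle_\Omega+K\|\varphi_T\|_\Omega,$$ $$J^{T_\varepsilon}_\varepsilon(\psi)=\frac12\Big(\int_0^{T_\varepsilon}\|\varphi^\varepsilon(t;\psi,T_\varepsilon)\|_\omega\,dt\Big)^2+\langle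 y_0,\varphi^\varepsilon(0;\psi,T_\varepsilon)\rangle_\Omega+K\|\psi\|_\Omega .$$ Each of these functionals has a unique minimizer over $L^2(\Omega)$. *)

(* Defs.v *)
From HB Require Import structures.
From mathcomp Require Import all_boot all_order all_algebra.
From mathcomp Require Import all_classical all_reals all_analysis.

Set Implicit Arguments.
Unset Strict Implicit.
Unset Printing Implicit Defensive.
Import Order.TTheory GRing.Theory Num.Theory.
Import numFieldNormedType.Exports.

Local Open Scope classical_set_scope.
Local Open Scope ring_scope.

(* The Borel sigma-algebra of R^n, generated by the coordinates as the library
   does for tuples *)
Section measurable_rV.
Context {R : realType} (n : nat).

Let coor (i : 'I_n) (x : 'rV[R]_n) : measurableTypeR R := x ord0 i.

Let rV_set0 : g_sigma_preimage coor set0.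
Proof. exact: sigma_algebra0. Qed.

Let rV_setC A : g_sigma_preimage coor A -> g_sigma_preimage coor (~` A).
Proof. exact: sigma_algebraC. Qed.

Let rV_bigcup (F : _^nat) : (forall i, g_sigma_preimage coor (F i)) ->
  g_sigma_preimage coor (\bigcup_i (F i)).
Proof. exact: sigma_algebra_bigcup. Qed.

HB.instance Definition _ := @isMeasurable.Build (measure_tuple_display (R.-ocitv.-measurable).-sigma)
  'rV[R]_n (g_sigma_preimage coor) rV_set0 rV_setC rV_bigcup.

End measurable_rV.

Section measurable_rV_lemmas.
Context {R : realType}.

Lemma measurable_coord n (i : 'I_n) :
  measurable_fun [set: 'rV[R]_n] (fun x => x ord0 i : measurableTypeR R).
Proof.
move=> _ Y mY; rewrite setTI; apply: sub_sigma_algebra => /=.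
rewrite -bigcup_seq/=; exists i => /=; first by rewrite mem_index_enum.
by exists Y => //; rewrite setTI.
Qed.

Lemma measurable_fun_rV d (T : measurableType d) n (f : T -> 'rV[R]_n) :
  (forall i, measurable_fun setT (fun t => f t ord0 i : measurableTypeR R)) ->
  measurable_fun setT f.
Proof.
move=> mf; pose coor (i : 'I_n) (x : 'rV[R]_n) : measurableTypeR R := x ord0 i.
apply: (@measurability _ _ _ _ _ f (\big[setU/set0]_(i < n)
  preimage_set_system setT (coor i) measurable)) => // _ [C + <-].
rewrite -bigcup_seq => -[i _ [Y mY <-]].
by rewrite !setTI -comp_preimage -[X in measurable X]setTI; exact: (mf i).
Qed.

Definition rVcons n (p : measurableTypeR R * 'rV[R]_n) : 'rV[R]_n.+1 :=
  row_mx (const_mx p.1 : 'rV_1) p.2.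

Lemma measurable_rVcons n : measurable_fun setT (@rVcons n).
Proof.
apply: measurable_fun_rV => i; case: (split_ordP (i : 'I_(1 + n))) => j ->.
  rewrite (_ : (fun _ => _) = fst) //.
  apply/funext => -[x v].
  by apply: etrans (@row_mxEl _ 1 1 n _ _ _ _) _; rewrite mxE.
rewrite (_ : (fun _ => _) = (fun v : 'rV[R]_n => v ord0 j) \o snd).
  by apply: measurableT_comp; [exact: measurable_coord|exact: measurable_snd].
by apply/funext => -[x v]; exact: (@row_mxEr _ 1 1 n).
Qed.

Let rVuncons n (v : 'rV[R]_n.+1) : measurableTypeR R * 'rV[R]_n :=
  (v ord0 ord0, @rsubmx _ 1 1 n v).

Let rVconsK n : cancel (@rVcons n) (@rVuncons n).
Proof.
move=> [x v]; rewrite /rVuncons row_mxKr; congr pair.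
have -> : (ord0 : 'I_n.+1) = @lshift 1 n ord0 by exact/val_inj.
by apply: etrans (@row_mxEl _ 1 1 n _ _ _ _) _; rewrite mxE.
Qed.

Let measurable_rVuncons n : measurable_fun setT (@rVuncons n).
Proof.
apply/measurable_fun_pairP; split; first exact: measurable_coord.
apply: measurable_fun_rV => i.
rewrite (_ : (fun _ => _) = fun v : 'rV[R]_n.+1 => v ord0 (rshift 1 i)).
  exact: measurable_coord.
by apply/funext => v; rewrite /= mxE.
Qed.

Section step.
Local Open Scope ereal_scope.
Context (n : nat) (m : {sigma_finite_measure set 'rV[R]_n -> \bar R}).

Definition leb_rV_step := pushforward (lebesgue_measure \x m) (@rVcons n).


Let step_measure : {measure set 'rV[R]_n.+1 -> \bar R} :=
  measure_function_pushforward__canonical__measure_function_Measure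
    (lebesgue_measure \x m) (@measurable_rVcons n).

HB.instance Definition _ := Measure.copy leb_rV_step step_measure.

Let leb_rV_step_sigma_finite : sigma_finite setT leb_rV_step.
Proof.
have /sigma_finiteP[F [TF ndF Foo]] := sigma_finiteT (@lebesgue_measure R).
have /sigma_finiteP[G [TG ndG Goo]] := sigma_finiteT m.
exists (fun k => @rVuncons n @^-1` (F k `*` G k)).
  apply/esym; rewrite -subTset => v _.
  have [i _ Fi] : (\bigcup_i F i) (rVuncons v).1 by rewrite -TF.
  have [j _ Gj] : (\bigcup_j G j) (rVuncons v).2 by rewrite -TG.
  exists (maxn i j) => //; split.
  - by move: Fi; exact/subsetPset/ndF/leq_maxl.
  - by move: Gj; exact/subsetPset/ndG/leq_maxr.
move=> k; have [mF Fk] := Foo k; have [mG Gk] := Goo k; split.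
  rewrite -[X in measurable X]setTI.
  by apply: measurable_rVuncons => //; exact: measurableX.
rewrite /leb_rV_step /pushforward -comp_preimage.
rewrite (_ : _ \o _ = id); last by apply/funext => p /=; rewrite rVconsK.
by rewrite preimage_id product_measure1E// lte_mul_pinfty// ge0_fin_numE.
Qed.

HB.instance Definition _ := Measure_isSigmaFinite.Build _ _ _ leb_rV_step
  leb_rV_step_sigma_finite.

End step.
End measurable_rV_lemmas.

(* Lebesgue measure on the Borel sets of R^n *)
Fixpoint leb_rV (R : realType) (n : nat) :
    {sigma_finite_measure set 'rV[R]_n -> \bar R} :=
  match n with
  | 0 => \d_ (0 : 'rV[R]_0)
  | n'.+1 => leb_rV_step (leb_rV R n')
  end.

Section spaces.
Context {R : realType} (N : nat).
Local Notation V := 'rV[R]_N.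
Local Notation leb := (leb_rV R N).
Implicit Types (D : set V) (u v w : V -> R) (g h : 'I_N -> V -> R).

(* Elements of L^2(D) and L^oo(D) are represented by functions on R^N of which
   only the values on D matter; equality in L^2(D) is [normL2 D (u \- v) = 0] *)
Definition L2 D u := u \_ D \in Lfun leb 2%:E.

Definition normL2 D u : R := fine 'N[leb]_2%:E[EFin \o u \_ D].

Definition innerL2 D u v : R := \int[leb]_(x in D) (u x * v x).

Definition Linfty D u := u \_ D \in Lfun leb +oo%E.

Definition normLinfty D u : \bar R := 'N[leb]_+oo[EFin \o u \_ D].

Definition partial (i : 'I_N) u : V -> R := fun x => 'D_(delta_mx ord0 i) u x.

Definition smooth u := forall s : seq 'I_N,
  let du := foldr partial u s in
  continuous du /\ forall i x, derivable du x (delta_mx ord0 i).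

Definition test_function D u :=
  smooth u /\ exists C, [/\ compact C, C `<=` D & forall x, ~ C x -> u x = 0].

(* [H10 D u g]: u belongs to H^1_0(D), the closure of C_c^oo(D) in H^1(D), and
   g is its weak gradient *)
Definition H10 D u g := [/\ L2 D u, forall i, L2 D (g i) &
  exists p : nat -> V -> R, [/\ forall n, test_function D (p n),
    normL2 D (p n \- u) @[n --> \oo] --> (0 : R) &
    forall i, normL2 D (partial i (p n) \- g i) @[n --> \oo] --> (0 : R)]].

(* Near each of its boundary points, D is the sublevel set of a smooth function
   with non-vanishing gradient *)
Definition smooth_boundary D := forall x0, (closure D `\` D°) x0 ->
  exists U rho, [/\ nbhs x0 U, smooth rho, exists i, partial i rho x0 != 0 &
    D `&` U = [set x | rho x < 0] `&` U].

Definition smooth_bounded_domain D :=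
  [/\ open D, connected D, D !=set0, bounded_set D & smooth_boundary D].

End spaces.

Section equations.
Context {R : realType} (N : nat).
Local Notation V := 'rV[R]_N.
Local Notation mu := (@lebesgue_measure R).
Implicit Types (D omega : set V) (a phiT psi : V -> R) (y phi : R -> V -> R).

(* [energy_class D T y g]: y belongs to C([0,T]; L^2(D)) and
   L^2(0,T; H^1_0(D)), with spatial gradient g in L^2(0,T; L^2(D)^N). Since
   L^2(D) is separable, strong measurability of g is stated in weak form. *)
Definition energy_class D (T : R) y (g : R -> 'I_N -> V -> R) :=
  [/\ forall t, t \in `[0, T] -> L2 D (y t),
      forall t, t \in `[0, T] ->
        normL2 D (y s \- y t) @[s --> within [set` `[0, T]] (nbhs t)] --> (0 : R),
      {ae mu, forall t, t \in `]0, T[ -> H10 D (y t) (g t)},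
      forall i t, t \in `]0, T[ -> L2 D (g t i) &
      forall i, (forall w, L2 D w ->
          measurable_fun (`]0, T[ : set (measurableTypeR R))
            (fun t => innerL2 D (g t i) w : measurableTypeR R)) /\
        (\int[mu]_(t in `]0%R, T[) (normL2 D (g t i) ^+ 2)%:E < +oo)%E].

(* Weak solution on [0,T] of y_t - Delta y - a y = 0 in D, y = 0 on the
   boundary of D, y(0) = y0: the variational equation
   <y_t, v> + <grad y, grad v> = <a y, v> for all v in H^1_0(D), integrated
   over (0,t) *)
Definition forward_solution D a (T : R) (y0 : V -> R) y :=
  exists g, [/\ energy_class D T y g, normL2 D (y 0 \- y0) = 0 &
    forall v h, H10 D v h -> forall t, t \in `[0, T] ->
      innerL2 D (y t) v +
        \int[mu]_(s in `]0, t[) (\sum_(i < N) innerL2 D (g s i) (h i)) =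
      innerL2 D y0 v + \int[mu]_(s in `]0, t[) innerL2 D (a \* y s) v].

(* Weak solution on [0,T] of phi_t + Delta phi + a phi = 0 in D, phi = 0 on the
   boundary of D, phi(T) = phiT, the equation being integrated over (t,T) *)
Definition backward_solution D a (T : R) phiT phi :=
  exists g, [/\ energy_class D T phi g, normL2 D (phi T \- phiT) = 0 &
    forall v h, H10 D v h -> forall t, t \in `[0, T] ->
      innerL2 D (phi t) v +
        \int[mu]_(s in `]t, T[) (\sum_(i < N) innerL2 D (g s i) (h i)) =
      innerL2 D phiT v + \int[mu]_(s in `]t, T[) innerL2 D (a \* phi s) v].

(* [Phi psi t] stands for the value at time t of the backward solution with
   final datum psi *)
Definition J D omega (K : R) (y0 : V -> R) (T : R) (Phi : (V -> R) -> R -> V -> R) psi : R :=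
  2^-1 * (\int[mu]_(t in `[0, T]) normL2 omega (Phi psi t)) ^+ 2
  + innerL2 D y0 (Phi psi 0) + K * normL2 D psi.

Definition minimizer D (F : (V -> R) -> R) psi :=
  L2 D psi /\ forall w, L2 D w -> F psi <= F w.

Definition unique_minimizer D (F : (V -> R) -> R) psi :=
  minimizer D F psi /\
  forall w, minimizer D F w -> normL2 D (w \- psi) = 0.

End equations.

(* Main.v *)
(* Write the cost of an observation psi as J(psi) = N(psi)^2/2 + <f, psi> + K |psi|,
   with N(psi) the time integral of |phi(t)|_omega, a seminorm bounded by the
   L^2-norm, and f = y(T) by duality; similarly for J_eps.

   Stability of minimizers. As |f| > K, the minimizer p of J is non-zero and
   N(p) > 0, and Fermat's rule at p gives
     J(psi) - J(p) >= (N(psi) - N(p))^2/2 + K (|psi| - <p, psi>/|p|).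
   Hence a minimizing sequence converges in norm: its direction converges to that
   of p and its length is then determined by N. The argument bears perturbations
   of N and of the linear part by d |psi| with d -> 0. No compactness and no
   unique continuation are needed: the existence of the minimizer of J replaces
   them.

   Evolution equations. For solutions u, w (of forward equations, after time
   reversal) with potentials a and b, the function F(s, t) = <u(s), w(t)> satisfies
   d_s F - d_t F = <(a - b) u(s), w(t)>, because both derivatives contain the same
   gradient term. This is integrated over rectangles, then along the lines
   s + t = const. With a = b it yields duality and the identity
   <u(s), u(t)> = |u((s+t)/2)|^2; the latter and the positivity of the double mean
   of the gradients over a square give the energy bound. With a <> b it yields the
   estimates in |a - b|_oo.

   The rectangle identities need Fubini's theorem for <g(s), k(t)> with g, k only
   weakly measurable. It is obtained by representing the mean of a curve, as a
   linear form, by vectors up to a small error. *)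
From HB Require Import structures.
Require Import Defs.
From mathcomp Require Import all_boot all_order all_algebra.
From mathcomp Require Import all_classical all_reals all_analysis.
From mathcomp Require Import measurable_realfun ess_sup_inf ring lra.
Import Order.TTheory GRing.Theory Num.Theory.
Import numFieldNormedType.Exports.

Set Implicit Arguments.
Unset Strict Implicit.
Unset Printing Implicit Defensive.

Local Open Scope classical_set_scope.
Local Open Scope ring_scope.

Ltac ilra := intros; lra.
Ltac inra := intros; nra.

(** * Semi-inner products *)

Section semi_inner_product.
Context {R : realType} {E : lmodType R}.
Implicit Types (B : E -> E -> R) (x y z : E).

(** Semidefinite only: in the application vectors are functions, not classes modulo null sets, so a
    vector of seminorm zero may differ from 0. *)
Record semi_inner B : Prop := SemiInner {
  form_lin : forall c x y z, B (c *: x + y) z = c * B x z + B y z ;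
  formC : forall x y, B x y = B y x ;
  form_ge0 : forall x, 0 <= B x x }.

Variable B : E -> E -> R.
Hypothesis siB : semi_inner B.

Definition fnorm x : R := Num.sqrt (B x x).

Lemma form0l z : B 0 z = 0.
Proof. by have := form_lin siB (-1) 0 0 z; rewrite scaler0 add0r; ilra. Qed.

Lemma formZl c x z : B (c *: x) z = c * B x z.
Proof. by rewrite -{1}[c *: x]addr0 (form_lin siB) form0l addr0. Qed.

Lemma formDl x y z : B (x + y) z = B x z + B y z.
Proof. by rewrite -{1}[x]scale1r (form_lin siB) mul1r. Qed.

Lemma formNl x z : B (- x) z = - B x z.
Proof. by rewrite -scaleN1r formZl mulN1r. Qed.

Lemma formBl x y z : B (x - y) z = B x z - B y z.
Proof. by rewrite formDl formNl. Qed.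

Lemma formZr c x z : B z (c *: x) = c * B z x.
Proof. by rewrite (formC siB) formZl (formC siB). Qed.

Lemma formDr x y z : B z (x + y) = B z x + B z y.
Proof. by rewrite (formC siB) formDl !(formC siB z). Qed.

Lemma formBr x y z : B z (x - y) = B z x - B z y.
Proof. by rewrite (formC siB) formBl !(formC siB z). Qed.

Lemma fnorm_ge0 x : 0 <= fnorm x.
Proof. exact: sqrtr_ge0. Qed.

Lemma sqr_fnorm x : fnorm x ^+ 2 = B x x.
Proof. by rewrite sqr_sqrtr// (form_ge0 siB). Qed.

Lemma formD_sqr c x y :
  B (x + c *: y) (x + c *: y) = B x x + 2 * c * B x y + c ^+ 2 * B y y.
Proof.
rewrite formDl !formDr !formZl !formZr (formC siB y x); ring.
Qed.

Lemma form_le x y : `|B x y| <= fnorm x * fnorm y.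
Proof.
rewrite -(ler_pXn2r (n := 2))// ?nnegrE ?mulr_ge0 ?fnorm_ge0//.
rewrite real_normK ?num_real// exprMn !sqr_fnorm.
have [y0|y0] := eqVneq (B y y) 0.
  suff -> : B x y = 0 by rewrite y0 mulr0 expr0n.
  apply/eqP; apply: contraT => xy0.
  (* With this coefficient the form would take the value -1. *)
  have := form_ge0 siB (x + (- (B x x + 1) / (2 * B x y)) *: y).
  rewrite formD_sqr y0 mulr0 addr0.
  suff -> : 2 * (- (B x x + 1) / (2 * B x y)) * B x y = - (B x x + 1) by ilra.
  by field.
have yp : 0 < B y y by rewrite lt0r y0 (form_ge0 siB).
have := form_ge0 siB (x + (- B x y / B y y) *: y).
rewrite formD_sqr.
have -> : B x x + 2 * (- B x y / B y y) * B x y + (- B x y / B y y) ^+ 2 * B y y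
   = (B x x * B y y - B x y ^+ 2) / B y y by field.
by rewrite pmulr_lge0 ?invr_gt0// subr_ge0.
Qed.

Lemma fnormD x y : fnorm (x + y) <= fnorm x + fnorm y.
Proof.
rewrite -(ler_pXn2r (n := 2))// ?nnegrE ?addr_ge0 ?fnorm_ge0//.
rewrite sqr_fnorm -[y]scale1r formD_sqr scale1r sqrrD !sqr_fnorm.
by have := form_le x y; rewrite ler_norml => /andP[_]; ilra.
Qed.

Lemma fnormZ c x : fnorm (c *: x) = `|c| * fnorm x.
Proof.
by rewrite /fnorm formZl formZr mulrA -expr2 sqrtrM ?sqr_ge0// sqrtr_sqr.
Qed.

Lemma fnormN x : fnorm (- x) = fnorm x.
Proof. by rewrite -scaleN1r fnormZ normrN1 mul1r. Qed.

Lemma fnormBC x y : fnorm (x - y) = fnorm (y - x).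
Proof. by rewrite -opprB fnormN. Qed.

Lemma fnorm0 : fnorm 0 = 0.
Proof. by rewrite /fnorm form0l sqrtr0. Qed.

Lemma fnorm_triangle z x y : fnorm (x - y) <= fnorm (x - z) + fnorm (z - y).
Proof. by rewrite -{1}(subrKA z x (- y)) fnormD. Qed.

Lemma ler_dist_fnorm x y : `|fnorm x - fnorm y| <= fnorm (x - y).
Proof.
have h a b : fnorm a - fnorm b <= fnorm (a - b).
  by rewrite lerBlDr -{1}(subrK b a) fnormD.
by rewrite ler_norml h andbT lerNl opprB fnormBC h.
Qed.

(** The choice y = x suffices. Norm estimates for flows are read off in this way from bilinear
    identities. *)
Lemma fnorm_le x (c : R) : 0 <= c -> (forall y, `|B x y| <= c * fnorm y) ->
  fnorm x <= c.
Proof.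
move=> c0 /(_ x); rewrite -sqr_fnorm ger0_norm ?sqr_ge0// expr2.
have := fnorm_ge0 x; rewrite le0r => /predU1P[->//|x0].
by rewrite ler_pM2r.
Qed.

End semi_inner_product.

(** * Stability of minimizers *)

Ltac nonneg := repeat first
  [ done | by apply: ltW | apply: fnorm_ge0 | apply: sqr_ge0 | apply: exprn_ge0
  | apply: divr_ge0 | apply: mulr_ge0 | apply: addr_ge0].

Section stability_of_minimizers.
Context {R : realType} {E : lmodType R} (B : E -> E -> R).
Hypothesis siB : semi_inner B.
Local Notation nrm := (fnorm B).
Variables (N : E -> R) (C K : R) (f p : E).
Hypothesis N_ge0 : forall x, 0 <= N x.
Hypothesis NZ : forall c x, N (c *: x) = `|c| * N x.
Hypothesis ND : forall x y, N (x + y) <= N x + N y.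
Hypothesis N_le : forall x, N x <= C * nrm x.
Hypothesis C_ge0 : 0 <= C.
Hypothesis K_gt0 : 0 < K.
Hypothesis K_lt : K < nrm f.
Let Jf x := 2^-1 * N x ^+ 2 + B f x + K * nrm x.
Hypothesis p_min : forall x, Jf p <= Jf x.

(** At -s f the first-order terms of J give -s (|f|^2 - K |f|), which beats the quadratic term for
    small s because K < |f|. *)
Let Jp_lt0 : Jf p < 0.
Proof.
have f0 : 0 < nrm f by exact: lt_trans K_lt.
have [s [s0 hs]] : exists s, 0 < s /\ s * N f ^+ 2 < nrm f ^+ 2 - K * nrm f.
  exists ((nrm f ^+ 2 - K * nrm f) / (N f ^+ 2 + 1)).
  have d0 : 0 < nrm f ^+ 2 - K * nrm f by rewrite expr2 -mulrBl mulr_gt0 ?subr_gt0.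
  have n0 : 0 < N f ^+ 2 + 1 by rewrite ltr_wpDl ?sqr_ge0.
  split; first exact: divr_gt0.
  by rewrite mulrAC ltr_pdivrMr// ltr_pM2l// ltrDl.
apply: le_lt_trans (p_min (- s *: f)) _.
rewrite /Jf NZ (fnormZ siB) (formZr siB) normrN (gtr0_norm s0) -(sqr_fnorm siB).
have -> : 2^-1 * (s * N f) ^+ 2 + - s * nrm f ^+ 2 + K * (s * nrm f) =
  s * (2^-1 * (s * N f ^+ 2) - (nrm f ^+ 2 - K * nrm f)) by field.
rewrite pmulr_rlt0//; have := sqr_ge0 (N f); inra.
Qed.

Let p_gt0 : 0 < nrm p.
Proof.
rewrite lt0r fnorm_ge0 andbT; apply/negP => /eqP p0.
have := Jp_lt0; rewrite /Jf p0 mulr0 addr0.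
have := N_ge0 p; have := N_le p; rewrite p0 mulr0 => h1 h2.
have -> : N p = 0 by ilra.
by have := form_le siB f p; rewrite p0 mulr0 normr_le0 => /eqP ->; ilra.
Qed.

(** If N vanished at p, J would be homogeneous of degree one on the ray through p, and 2 p would
    have a smaller value than p since J p < 0. *)
Let Np_gt0 : 0 < N p.
Proof.
rewrite lt0r N_ge0 andbT; apply/negP => /eqP p0.
have := Jp_lt0; have := p_min (2 *: p).
by rewrite /Jf NZ (fnormZ siB) (formZr siB) ger0_norm// p0; ilra.
Qed.

Let le0_small (a b : R) : (forall t, 0 < t <= 1 -> 0 <= a + t * b) -> 0 <= a.
Proof.
move=> h; rewrite leNgt; apply/negP => a0.
have n0 : 0 < `|b| - a by rewrite subr_gt0 (lt_le_trans a0).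
have := h (- a / (2 * (`|b| - a))); rewrite divr_gt0 ?oppr_gt0 ?mulr_gt0//.
rewrite ler_pdivrMr ?mulr_gt0// mul1r.
have -> : - a <= 2 * (`|b| - a) by have := normr_ge0 b; ilra.
move=> /(_ isT); rewrite leNgt => /negP; apply.
rewrite mulrAC -ltrBrDl sub0r ltr_pdivrMr ?mulr_gt0//.
by have := ler_norm b; inra.
Qed.

(* Fermat's rule at p in the direction x: as N is a seminorm, the one-sided
   derivative of N^2/2 at p is at most N p * N x. *)
Let subgradient x : 0 <= B f x + N p * N x + K * (B p x / nrm p).
Proof.
apply: (@le0_small _ (2^-1 * N x ^+ 2 + K * (B x x / (2 * nrm p)))) => t /andP[t0 _].
have := p_min (p + t *: x); rewrite /Jf (formDr siB) (formZr siB).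
have hN : N (p + t *: x) ^+ 2 <= (N p + t * N x) ^+ 2.
  rewrite ler_pXn2r// ?nnegrE ?addr_ge0 ?mulr_ge0// ?N_ge0 ?(ltW t0)//.
  by rewrite (le_trans (ND _ _))// NZ gtr0_norm.
(* The inequality 2 |p| |p + t x| <= |p|^2 + |p + t x|^2 yields a quadratic majorant of the norm
   around p. *)
have hn : nrm (p + t *: x) <=
    nrm p + t * (B p x / nrm p) + t ^+ 2 * (B x x / (2 * nrm p)).
  have h2 : nrm (p + t *: x) ^+ 2 = nrm p ^+ 2 + 2 * t * B p x + t ^+ 2 * B x x.
    by rewrite !(sqr_fnorm siB) (formD_sqr siB).
  have -> : nrm p + t * (B p x / nrm p) + t ^+ 2 * (B x x / (2 * nrm p)) =
    (nrm p ^+ 2 + nrm (p + t *: x) ^+ 2) / (2 * nrm p).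
    by rewrite h2; field; rewrite gt_eqF.
  rewrite ler_pdivlMr ?mulr_gt0//.
  by have := sqr_ge0 (nrm p - nrm (p + t *: x)); ilra.
move=> h; rewrite -(pmulr_rge0 _ t0).
have := ler_wpM2l (ltW K_gt0) hn; inra.
Qed.

(** Fermat's rule along (1 - t) p, where N and the norm are exactly homogeneous. *)
Let euler : B f p <= - N p ^+ 2 - K * nrm p.
Proof.
suff: 0 <= - N p ^+ 2 - K * nrm p - B f p by ilra.
apply: (@le0_small _ (2^-1 * N p ^+ 2)) => t /andP[t0 t1].
have := p_min ((1 - t) *: p).
rewrite /Jf NZ (fnormZ siB) (formZr siB) ger0_norm ?subr_ge0// => h.
by rewrite -(pmulr_rge0 _ t0); inra.
Qed.

(** Rests on 2 c <= (2 c + 1)^2, which keeps square roots out of the constants. *)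
Let sqr_small (th c m X : R) : 0 <= th -> 0 <= c -> 0 <= m -> 0 <= X ->
  X ^+ 2 <= 2 * c * th ^+ 2 * m ^+ 2 -> X <= th * (2 * c + 1) * m.
Proof.
move=> th0 c0 m0 X0 h.
rewrite -(ler_pXn2r (n := 2))// ?nnegrE ?mulr_ge0 ?addr_ge0 ?mulr_ge0//.
apply: (le_trans h); rewrite -subr_ge0.
have -> : (th * (2 * c + 1) * m) ^+ 2 - 2 * c * th ^+ 2 * m ^+ 2 =
  th ^+ 2 * m ^+ 2 * ((2 * c + 1) ^+ 2 - 2 * c) by ring.
by rewrite !mulr_ge0 ?sqr_ge0//; nra.
Qed.

(** It is enough that q does at least as well as p for the perturbed functional. The vector q is
    split into its projection (b / P) p and a remainder of norm h. Fermat's rule bounds h and r - b;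
    the closeness of N q to N p then places b near P. *)
Lemma perturbed_minimizer_near : forall eta, 0 < eta -> exists2 d, 0 < d &
  forall (M L : E -> R) q,
  (forall x, 0 <= M x) -> (forall x, `|M x - N x| <= d * nrm x) ->
  (forall x, `|L x - B f x| <= d * nrm x) ->
  2^-1 * M q ^+ 2 + L q + K * nrm q <= 2^-1 * M p ^+ 2 + L p + K * nrm p ->
  nrm (q - p) <= eta.
Proof.
move=> eta eta0.
have P0 := p_gt0; have n0 := Np_gt0; set P := nrm p in P0 *; set n := N p in n0 *.
pose c2 := n * P + P ^+ 2 + P + n + 1.
have c20 : 0 <= c2 by rewrite /c2; nonneg.
pose k2 := c2 / K; have k20 : 0 <= k2 by rewrite /k2; nonneg.
pose k3 := 2 * c2 + 1 + 1 + C * (2 * k2 + 1).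
have k30 : 0 <= k3 by rewrite /k3; nonneg.
pose k4 := k3 * (P / n) + k2.
have k40 : 0 <= k4 by rewrite /k4; nonneg.
pose k5 := (2 * k2 + 1 + k4) * (2 * P + 2).
have k50 : 0 < k5.
  rewrite mulr_gt0//; last by have := P0; ilra.
  by have := k20; have := k40; ilra.
(* The three bounds serve, in order, d <= th, the absorption of r in [rP], and the final estimate by
   eta. *)
pose th := Num.min 1 (Num.min (2 * (k4 + 1))^-1 (eta / k5)).
have k41 : 0 < 2 * (k4 + 1) by rewrite mulr_gt0// ltr_wpDl.
have th0 : 0 < th by rewrite !lt_min ltr01 invr_gt0 k41 divr_gt0.
have th1 : th <= 1 by rewrite ge_min lexx.
have thk4 : th * k4 <= 2^-1.
  have : th <= (2 * (k4 + 1))^-1 by rewrite !ge_min lexx orbT.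
  by rewrite -div1r ler_pdivlMr//; inra.
have thk5 : th * k5 <= eta.
  have : th <= eta / k5 by rewrite !ge_min lexx !orbT.
  by rewrite ler_pdivlMr.
(* A square, because h and |M q - n| are controlled through their squares. *)
exists (th ^+ 2) => [|M L q M0 MN Lf le_qp]; first by rewrite exprn_gt0.
set d := th ^+ 2 in MN Lf.
have d0 : 0 < d by rewrite exprn_gt0.
have d1 : d <= th by rewrite /d expr2 ler_piMl// ltW.
pose r := nrm q; have r0 : 0 <= r by exact: fnorm_ge0.
pose b := B p q / P.
have br : `|b| <= r.
  rewrite normrM normfV (gtr0_norm P0) ler_pdivrMr// mulrC.
  exact: form_le siB _ _.
pose m := r + 1; have m1 : 1 <= m by rewrite /m lerDr.
pose h := nrm (q - (b / P) *: p); have h0 : 0 <= h by exact: fnorm_ge0.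
have h2 : h ^+ 2 = (r - b) * (r + b).
  rewrite /h (sqr_fnorm siB) -scaleNr (formD_sqr siB) -!(sqr_fnorm siB) -/P -/r.
  rewrite (formC siB q p) (_ : B p q = b * P); last by rewrite divfK// gt_eqF.
  by field; rewrite gt_eqF.
(* Fermat's rule at p in the direction q is combined with the assumed comparison of q with p; the
   perturbation costs d times a multiple of m = r + 1. *)
have key : 2^-1 * (M q - n) ^+ 2 + K * (r - b) <= d * (c2 * m).
  have := MN p; rewrite ler_norml -/P -/n => /andP[_ MNp].
  have := Lf p; rewrite ler_norml -/P => /andP[_ Lfp].
  have := MN q; rewrite ler_norml -/r => /andP[MNq _].
  have := Lf q; rewrite ler_norml -/r => /andP[Lfq _].
  have := subgradient q; rewrite -/P -/n -/b => sg.
  have := euler; rewrite -/P -/n => eu.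
  have Mp2 : M p ^+ 2 <= (n + d * P) ^+ 2.
    by have := M0 p; have := mulr_ge0 (ltW d0) (ltW P0); inra.
  have dP : d ^+ 2 * P ^+ 2 <= d * P ^+ 2.
    by rewrite ler_wpM2r ?sqr_ge0// expr2 ler_piMl ?(ltW d0)// (le_trans d1).
  have nN : n * N q <= n * M q + n * (d * r).
    by rewrite -mulrDr ler_wpM2l ?(ltW n0)//; lra.
  have e1 : d * (n * P + P ^+ 2 + P) + (n + 1) * (d * r) <= d * (c2 * m).
    have -> : d * (n * P + P ^+ 2 + P) + (n + 1) * (d * r) =
      d * (n * P + P ^+ 2 + P + (n + 1) * r) by ring.
    rewrite ler_wpM2l ?(ltW d0)//.
    have : 0 <= (n * P + P ^+ 2 + P) * r by nonneg.
    by rewrite /c2 /m; ilra.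
  have e2 : 2^-1 * M p ^+ 2 + d * P <= 2^-1 * n ^+ 2 + d * (n * P + P ^+ 2 + P).
    have := mulr_ge0 (ltW d0) (sqr_ge0 P).
    by lra.
  have e3 : 2^-1 * M p ^+ 2 + L p + K * P <=
      - (2^-1 * n ^+ 2) + d * (n * P + P ^+ 2 + P) by lra.
  have e4 : 2^-1 * M q ^+ 2 - n * M q - (n + 1) * (d * r) + K * (r - b) <=
      2^-1 * M q ^+ 2 + L q + K * nrm q by rewrite -/r; lra.
  by lra.
have rb0 : 0 <= r - b by have := ler_norm b; ilra.
have dcm : d * (c2 * m) <= d * c2 * m ^+ 2.
  have m2 : m <= m ^+ 2 by rewrite expr2 ler_peMl//; lra.
  by have := ler_wpM2l (mulr_ge0 (ltW d0) c20) m2; ilra.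
have Mqn : `|M q - n| <= th * (2 * c2 + 1) * m.
  apply: sqr_small; rewrite ?(ltW th0)// ?(le_trans ler01)//.
  rewrite real_normK ?num_real// -/d.
  by have h3 := mulr_ge0 (ltW K_gt0) rb0; lra.
have rb : r - b <= d * k2 * m.
  rewrite /k2 mulrAC mulrA ler_pdivlMr// mulrC.
  by have := sqr_ge0 (M q - n); ilra.
have rb' : r - b <= th * k2 * m.
  by apply: (le_trans rb); rewrite ler_wpM2r ?ler_wpM2r//; ilra.
(* In h^2 = (r - b) (r + b) the first factor is of order d m and the second is at most 2 m. *)
have hm : h <= th * (2 * k2 + 1) * m.
  apply: sqr_small; rewrite ?(ltW th0)// ?(le_trans ler01)// h2 -/d.
  have b2 : r + b <= 2 * m by have := ler_norm b; rewrite /m; ilra.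
  have rb2 : 0 <= r + b by move: br; rewrite ler_norml => /andP[+ _]; ilra.
  have := ler_pM rb0 rb2 rb b2.
  by rewrite expr2; ilra.
have Nb : N ((b / P) *: p) = `|b| / P * n.
  by rewrite NZ -/n normrM normfV (gtr0_norm P0).
have Nh x : N x <= C * nrm x by exact: N_le.
have N1 : `|b| / P * n <= N q + C * h.
  rewrite -Nb (_ : (b / P) *: p = q + (-1) *: (q - (b / P) *: p)); last first.
    by rewrite scaleN1r opprB addrC subrK.
  rewrite (le_trans (ND _ _))// lerD2l NZ normrN1 mul1r.
  exact: N_le.
have N2 : N q <= `|b| / P * n + C * h.
  rewrite -Nb -{1}(subrK ((b / P) *: p) q) addrC (le_trans (ND _ _))// lerD2l.
  exact: N_le.
have Ch : C * h <= C * (2 * k2 + 1) * (th * m).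
  by rewrite -mulrA ler_wpM2l// (le_trans hm)// mulrAC mulrC.
have dr : d * r <= th * m.
  by rewrite ler_pM ?(ltW d0)// /m lerDl.
have := MN q; rewrite ler_norml -/r => /andP[MN1 MN2].
move: Mqn; rewrite ler_norml => /andP[Mq1 Mq2].
(* N takes the value |b| n / P at the projection, which is within C h of N q; N q is within d r of M
   q, and M q is near n. *)
have A1 : `| `|b| / P * n - n| <= k3 * (th * m).
  by rewrite /k3 ler_norml; apply/andP; split; ilra.
have A2 : `| `|b| - P| <= k3 * (P / n) * (th * m).
  have -> : `|b| - P = (P / n) * (`|b| / P * n - n).
    by field; rewrite !gt_eqF.
  rewrite normrM gtr0_norm ?divr_gt0//.
  by have := ler_wpM2l (ltW (divr_gt0 P0 n0)) A1; ilra.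
(* The sign of b is controlled by |b| - b <= r - b. *)
have A3 : `|b - P| <= k4 * (th * m).
  move: A2; rewrite /k4 !ler_norml => /andP[a1 a2].
  by have hb := ler_norm b; apply/andP; split; lra.
(* Absorption: r <= P + m / 2 with m = r + 1. *)
have rP : r <= 2 * P + 1.
  move: A3; rewrite ler_norml => /andP[_ a2].
  have : r <= P + k4 * (th * m).
    move: A2; rewrite ler_norml => /andP[_ a3]; rewrite /k4.
    by have := ler_norm b; ilra.
  have : k4 * (th * m) <= 2^-1 * m.
    by rewrite mulrA (mulrC k4) ler_wpM2r//; ilra.
  by rewrite /m; ilra.
have mP : m <= 2 * P + 2 by rewrite /m; ilra.
rewrite (le_trans _ thk5)// (le_trans (fnorm_triangle siB ((b / P) *: p) _ _))//.
have -> : nrm ((b / P) *: p - p) = `|b - P|.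
  rewrite -{2}[p]scale1r -scalerBl (fnormZ siB) -/P.
  rewrite -{2}(gtr0_norm P0) -normrM mulrBl mul1r divfK//.
  by rewrite gt_eqF.
rewrite -/h.
have c5 : 0 <= th * (2 * k2 + 1 + k4) by nonneg.
by have := ler_wpM2l c5 mP; rewrite /k5; ilra.
Qed.

End stability_of_minimizers.

(** * Weakly measurable curves *)

(** The range e <= 1 lets quadratic errors e^2 be absorbed into linear ones. *)
Lemma ler0_eps_scale {R : realFieldType} (x c : R) :
  (forall e, 0 < e <= 1 -> x <= e * c) -> x <= 0.
Proof.
move=> h; rewrite leNgt; apply/negP => x0.
have c0 : 0 < `|c| + x by rewrite ltr_wpDl.
have d0 : 0 < 2 * (`|c| + x) by rewrite mulr_gt0.
have := h (x / (2 * (`|c| + x))); rewrite divr_gt0//= ler_pdivrMr// mul1r.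
have -> : x <= 2 * (`|c| + x) by have := normr_ge0 c; ilra.
move=> /(_ isT); rewrite leNgt => /negP; apply.
by rewrite mulrAC ltr_pdivrMr// ltr_pM2l//; have := ler_norm c; ilra.
Qed.

Section weak_curves.
Context {R : realType} {E : lmodType R} (B : E -> E -> R).
Hypothesis siB : semi_inner B.
Local Notation nrm := (fnorm B).

(* Riesz representation up to an error [e]: no completeness is required. *)
Lemma near_representer (l : E -> R) (C e : R) :
  (forall c x y, l (c *: x + y) = c * l x + l y) -> 0 <= C ->
  (forall x, `|l x| <= C * nrm x) -> 0 < e ->
  exists2 r, nrm r <= C + e & forall y, `|l y - B r y| <= e * nrm y.
Proof.
move=> l_lin C0 l_le e0.
pose Phi x := 2^-1 * B x x - l x.
have Phi_inf : has_inf (range Phi).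
  split; first by exists (Phi 0), 0.
  exists (- (2^-1 * C ^+ 2)) => _ [x _ <-]; rewrite /Phi -(sqr_fnorm siB).
  have := l_le x; rewrite ler_norml => /andP[_].
  by have := sqr_ge0 (nrm x - C); ilra.
have d0 : 0 < 2^-1 * e ^+ 2 by rewrite mulr_gt0// exprn_gt0.
have [_ [r _ <-] hr] := inf_adherent d0 Phi_inf.
(* As r minimizes [Phi] up to e^2 / 2, comparison with r + t y makes this polynomial in t
   nonnegative; its discriminant gives the claim. *)
have lr y t : 0 <= t ^+ 2 * B y y + 2 * t * (B r y - l y) + e ^+ 2.
  have : inf (range Phi) <= Phi (t *: y + r).
    by apply: ge_inf; [exact: Phi_inf.2|exists (t *: y + r)].
  move: hr; set m := inf _ => hr hm; have := lt_le_trans hr (lerD hm (lexx _)).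
  by rewrite /Phi l_lin (addrC (t *: y)) (formD_sqr siB); ilra.
have rep y : `|l y - B r y| <= e * nrm y.
  rewrite -(ler_pXn2r (n := 2))// ?nnegrE ?normr_ge0 ?mulr_ge0 ?fnorm_ge0 ?(ltW e0)//.
  rewrite real_normK ?num_real// exprMn (sqr_fnorm siB).
  set D := l y - B r y.
  have [y0|y0] := eqVneq (B y y) 0.
    have [->|D0] := eqVneq D 0; first by rewrite y0 expr0n mulr0.
    have := lr y ((e ^+ 2 + 1) / (2 * D)).
    rewrite y0 mulr0 add0r -opprB -/D.
    have -> : 2 * ((e ^+ 2 + 1) / (2 * D)) * - D = - (e ^+ 2 + 1) by field.
    by ilra.
  have yp : 0 < B y y by rewrite lt0r y0 (form_ge0 siB).
  have := lr y (D / B y y); rewrite -[B r y - _]opprB -/D.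
  have -> : (D / B y y) ^+ 2 * B y y + 2 * (D / B y y) * - D =
    - (D ^+ 2 / B y y) by field.
  by rewrite addrC subr_ge0 ler_pdivrMr.
exists r => //; apply: (fnorm_le siB); first by rewrite addr_ge0// ltW.
move=> y; have := rep y; have := l_le y.
by rewrite !ler_norml => /andP[? ?] /andP[? ?]; apply/andP; split; lra.
Qed.

(* The norm of a weakly measurable curve need not be known to be measurable:
   its integral is bounded from below through its measurable minorants only. *)
Definition weak_curve d (X : measurableType d) (mu : {measure set X -> \bar R})
    (I : set X) (G : X -> E) (C : R) :=
  (forall x, measurable_fun I (fun s => B (G s) x)) /\
  forall f : X -> R, measurable_fun I f ->
    (forall s, I s -> 0 <= f s <= nrm (G s)) ->
    (\int[mu]_(s in I) (f s)%:E <= C%:E)%E.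

Section one_curve.
Context d (X : measurableType d) (mu : {measure set X -> \bar R}).
Variables (I : set X) (G : X -> E) (C : R).
Hypotheses (mI : measurable I) (wcG : weak_curve mu I G C).

Lemma weak_curve_bound_ge0 : 0 <= C.
Proof.
have := wcG.2 (cst 0); rewrite integral0 lee_fin; apply.
  exact: measurable_cst.
by move=> s _; rewrite lexx fnorm_ge0.
Qed.

(** For k > 0 the function |f| / k is a measurable minorant of the norm of G; for k = 0 the function
    f vanishes on I. *)
Lemma weak_curve_dominated (f : X -> R) (k : R) : 0 <= k ->
  measurable_fun I f -> (forall s, I s -> `|f s| <= k * nrm (G s)) ->
  mu.-integrable I (EFin \o f) /\ `|\int[mu]_(s in I) f s| <= k * C.
Proof.
move=> k0 mf fG.
have int_le : (\int[mu]_(s in I) `|(f s)%:E| <= (k * C)%:E)%E.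
  have [k00|kn0] := eqVneq k 0.
    rewrite k00 mul0r integral0_eq// => s Is.
    by have := fG s Is; rewrite k00 mul0r normr_le0 => /eqP ->; rewrite abse0.
  have kp : 0 < k by rewrite lt0r kn0.
  have mf' : measurable_fun I (fun s => k^-1 * `|f s|).
    by apply: measurable_funM => //; exact: measurableT_comp.
  have : (k%:E * \int[mu]_(s in I) (k^-1 * `|f s|)%:E <= k%:E * C%:E)%E.
    rewrite lee_wpmul2l ?lee_fin//; apply: wcG.2 => // s Is.
    by rewrite mulr_ge0 ?invr_ge0//= mulrC ler_pdivrMr// mulrC fG.
  rewrite -ge0_integralZl//; last 2 first.
    exact/measurable_EFinP.
    by move=> s _; rewrite lee_fin mulr_ge0 ?invr_ge0.
  by under eq_integral do rewrite -EFinM mulrA divff// mul1r.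
have fint : mu.-integrable I (EFin \o f).
  apply/integrableP; split; first exact/measurable_EFinP.
  by rewrite (le_lt_trans int_le)// ltry.
split => //; apply: (le_trans (le_normr_Rintegral mI fint)).
rewrite /Rintegral -lee_fin fineK//.
by rewrite ge0_fin_numE ?integral_ge0// (le_lt_trans int_le)// ltry.
Qed.

Definition weak_mean x := \int[mu]_(s in I) B (G s) x.

Lemma weak_curve_form x : mu.-integrable I (fun s => (B (G s) x)%:E).
Proof.
apply: (weak_curve_dominated (fnorm_ge0 B x) (wcG.1 x) _).1 => s _.
by rewrite mulrC form_le.
Qed.

Lemma weak_mean_le x : `|weak_mean x| <= C * nrm x.
Proof.
rewrite mulrC; apply: (weak_curve_dominated (fnorm_ge0 B x) (wcG.1 x) _).2.
by move=> s _; rewrite mulrC form_le.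
Qed.

Lemma weak_mean_lin c x y :
  weak_mean (c *: x + y) = c * weak_mean x + weak_mean y.
Proof.
have zint := integrableZl mI c (weak_curve_form x).
rewrite /weak_mean -RintegralZl//; last exact: weak_curve_form.
rewrite -RintegralD//; last exact: weak_curve_form.
by apply: eq_Rintegral => s _; rewrite (formDr siB) (formZr siB).
Qed.

Lemma weak_mean_representer e : 0 < e ->
  exists2 r, nrm r <= C + e & forall y, `|weak_mean y - B r y| <= e * nrm y.
Proof.
by apply: near_representer;
  [exact: weak_mean_lin|exact: weak_curve_bound_ge0|exact: weak_mean_le].
Qed.

End one_curve.

Section two_curves.
Context d (X : measurableType d) (mu : {measure set X -> \bar R}).
Variables (I : set X) (G : X -> E) (C : R).
Hypotheses (mI : measurable I) (wcG : weak_curve mu I G C).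
Context d' (Y : measurableType d') (nu : {measure set Y -> \bar R}).
Variables (J : set Y) (W : Y -> E) (D : R).
Hypotheses (mJ : measurable J) (wcW : weak_curve nu J W D).
Local Notation l := (weak_mean mu I G).

(** The function is a pointwise limit of the measurable functions t -> B (W t) (r n), with r n a
    near-representer of the mean of error 1 / (n + 1). *)
Lemma measurable_weak_mean : measurable_fun J (fun t => l (W t)).
Proof.
have h n : exists r, forall y, `|l y - B r y| <= n.+1%:R^-1 * nrm y.
  have n0 : 0 < n.+1%:R^-1 :> R by rewrite invr_gt0.
  by have [r _ hr] := weak_mean_representer mI wcG n0; exists r.
have [r hr] := choice h.
apply: (@measurable_fun_cvg _ _ _ _ (fun n t => B (W t) (r n))).
  by move=> n; exact: wcW.1.
move=> t Jt; apply/cvgrPdist_le => /= e e0.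
near=> n; rewrite (formC siB); apply: (le_trans (hr n _)).
rewrite mulrC ler_pdivrMr// -ler_pdivrMl// mulrC.
rewrite (@le_trans _ _ n%:R)// ?ler_nat//.
by near: n; exact: nbhs_infty_ger.
Unshelve. all: by end_near. Qed.

(** Replacing the form [l] by the pairing with r costs at most e |W t| at each t, which integrates
    to e D. *)
Lemma weak_mean_comp :
  nu.-integrable J (fun t => (l (W t))%:E) /\
  forall e r, 0 < e -> (forall y, `|l y - B r y| <= e * nrm y) ->
    `|\int[nu]_(t in J) l (W t) - weak_mean nu J W r| <= e * D.
Proof.
have lint : nu.-integrable J (fun t => (l (W t))%:E).
  apply: (weak_curve_dominated mJ wcW (weak_curve_bound_ge0 wcG) _ _).1.
    exact: measurable_weak_mean.
  by move=> t _; exact: weak_mean_le.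
split => // e r e0 hr; rewrite {2}/weak_mean -RintegralB//; last first.
  exact: (weak_curve_form mJ wcW).
apply: (weak_curve_dominated mJ wcW (ltW e0) _ _).2.
  by apply: measurable_funB; [exact: measurable_weak_mean|exact: wcW.1].
by move=> t _; rewrite (formC siB (W t)).
Qed.

End two_curves.

Section weak_fubini.
Context d (X : measurableType d) (mu : {measure set X -> \bar R}).
Variables (I : set X) (G : X -> E) (C : R).
Hypotheses (mI : measurable I) (wcG : weak_curve mu I G C).

(* Both sides are limits of values of the form at near-representers of the two
   means. *)
Lemma weak_fubini d' (Y : measurableType d') (nu : {measure set Y -> \bar R})
    (J : set Y) (W : Y -> E) (D : R) : measurable J -> weak_curve nu J W D ->
  \int[nu]_(t in J) weak_mean mu I G (W t) =
  \int[mu]_(s in I) weak_mean nu J W (G s).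
Proof.
move=> mJ wcW.
have C0 := weak_curve_bound_ge0 wcG; have D0 := weak_curve_bound_ge0 wcW.
apply/eqP; rewrite -subr_eq0 -normr_le0.
(* Four errors add up: e D and e C from inserting near-representers r and q under the integrals, e
   |q| and e |r| from comparing both results with B q r. Moreover |r| <= C + e and |q| <= D + e. *)
apply: (@ler0_eps_scale _ _ (2 * C + 2 * D + 2)) => e /andP[e0 e1].
have [r rC hr] := weak_mean_representer mI wcG e0.
have [q qD hq] := weak_mean_representer mJ wcW e0.
have := (weak_mean_comp mI wcG mJ wcW).2 _ _ e0 hr.
have := (weak_mean_comp mJ wcW mI wcG).2 _ _ e0 hq.
have := hr q; have := hq r; rewrite (formC siB q r).
have := ler_wpM2l (ltW e0) rC; have := ler_wpM2l (ltW e0) qD.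
have : e * e <= e by rewrite ler_piMl// ltW.
rewrite !ler_norml => ? ? ? /andP[? ?] /andP[? ?] /andP[? ?] /andP[? ?].
by apply/andP; split; lra.
Qed.

(* The double mean is the limit of the squared norms of near-representers. *)
Lemma weak_double_mean_ge0 : 0 <= \int[mu]_(s in I) weak_mean mu I G (G s).
Proof.
have C0 := weak_curve_bound_ge0 wcG.
rewrite -oppr_le0.
apply: (@ler0_eps_scale _ _ (2 * C + 1)) => e /andP[e0 e1].
have [r rC hr] := weak_mean_representer mI wcG e0.
have := (weak_mean_comp mI wcG mI wcG).2 _ _ e0 hr.
have := hr r; have := form_ge0 siB r.
have := ler_wpM2l (ltW e0) rC.
have : e * e <= e by rewrite ler_piMl// ltW.
by rewrite !ler_norml => ? ? ? /andP[? ?] /andP[? ?]; lra.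
Qed.

End weak_fubini.
End weak_curves.

(** * Integrals over segments, transport and growth *)

Section reflection.
Context {R : realType}.
Local Notation mu := (@lebesgue_measure R).
Let reflect_fun (c : R) : measurableTypeR R -> measurableTypeR R := fun x => c - x.

Lemma measurable_subl (c : R) : measurable_fun setT (reflect_fun c).
Proof. by apply: measurable_funB => //; exact: measurable_cst. Qed.

Let reflected_measure (c : R) : {measure set (measurableTypeR R) -> \bar R} :=
  measure_function_pushforward__canonical__measure_function_Measure mu
  (measurable_subl c).

(** By uniqueness of Lebesgue measure it suffices to compare lengths of half-open intervals; the
    reflection exchanges their open and closed ends. *)
Lemma lebesgue_measure_subl (c : R) (A : set (measurableTypeR R)) :
  measurable A -> mu A = pushforward mu (reflect_fun c) A.
Proof.
move=> mA; apply: (@lebesgue_measure_unique R (reflected_measure c)) => //.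
move=> _ [[x1 x2] _ <-]; rewrite /= /pushforward (_ : _ @^-1` _ = `[c - x2, c - x1[%classic).
  rewrite !lebesgue_measure_itv/= !lte_fin ltrD2l ltrN2.
  by case: ifP => // _; rewrite -!EFinD; congr EFin; ring.
apply/seteqP; split => y; rewrite /reflect_fun/= !in_itv/= => /andP[h1 h2];
  apply/andP; split; lra.
Qed.

Lemma ge0_integral_subl (c : R) (D : set R) (f : R -> \bar R) :
  measurable (D : set (measurableTypeR R)) ->
  measurable_fun (D : set (measurableTypeR R)) f ->
  (forall x, D x -> (0 <= f x)%E) ->
  (\int[mu]_(x in D) f x =
   \int[mu]_(x in (fun x => (c - x)%R) @^-1` D) f (c - x)%R)%E.
Proof.
move=> mD mf f0; transitivity (\int[reflected_measure c]_(x in D) f x)%E.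
  apply: (@eq_measure_integral _ (measurableTypeR R) R D (reflected_measure c) mu f) => A mA _.
  exact: lebesgue_measure_subl.
rewrite ge0_integral_pushforward//; first exact: measurable_subl.
by move=> x /[!inE]; exact: f0.
Qed.

Lemma Rintegral_subl (c : R) (D : set R) (f : R -> R) :
  measurable (D : set (measurableTypeR R)) ->
  measurable_fun (D : set (measurableTypeR R)) f ->
  \int[mu]_(x in D) f x = \int[mu]_(x in (fun x => c - x) @^-1` D) f (c - x).
Proof.
move=> mD mf; rewrite /Rintegral; congr fine.
have mEf : measurable_fun (D : set (measurableTypeR R)) (EFin \o f).
  exact/measurable_EFinP.
rewrite [LHS]integralE [RHS]integralE; congr (_ - _)%E.
  rewrite (@ge0_integral_subl c)//; last exact: measurable_funepos.
  by apply: eq_integral => x _; rewrite !funeposE.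
rewrite (@ge0_integral_subl c)//; last exact: measurable_funeneg.
by apply: eq_integral => x _; rewrite !funenegE.
Qed.

Lemma preimage_subl_itvcc (c a b : R) :
  (fun x => c - x) @^-1` `[a, b]%classic = `[c - b, c - a]%classic.
Proof.
by apply/seteqP; split => y; rewrite /= !in_itv/= => /andP[h1 h2];
  apply/andP; split; lra.
Qed.

Lemma preimage_subl_itvoo (c a b : R) :
  (fun x => c - x) @^-1` `]a, b[%classic = `]c - b, c - a[%classic.
Proof.
by apply/seteqP; split => y; rewrite /= !in_itv/= => /andP[h1 h2];
  apply/andP; split; lra.
Qed.

End reflection.

(** Not the oriented integral: the value is 0 when b < a. *)
HB.lock Definition segint (R : realType) (a b : R) (f : R -> R) : R :=
  \int[@lebesgue_measure R]_(x in `[a, b]) f x.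
Canonical segint_unlockable := Unlockable segint.unlock.

Section continuous_integrals.
Context {R : realType}.
Local Notation mu := (@lebesgue_measure R).
Implicit Types (f : R -> R) (a b c : R).

Lemma continuous_integrable f a b : continuous f ->
  mu.-integrable `[a, b] (EFin \o f).
Proof.
move=> cf; apply: continuous_compact_integrable; first exact: segment_compact.
exact: continuous_subspaceT.
Qed.

Lemma continuous_measurable f (D : set R) : continuous f ->
  measurable_fun (D : set (measurableTypeR R)) f.
Proof.
by move=> cf; apply: measurable_funTS; exact: continuous_measurable_fun.
Qed.

Lemma integral_chasles f a b c : continuous f -> a <= b -> b <= c ->
  segint a c f = segint a b f + segint b c f.
Proof.
move=> cf ab bc; rewrite unlock.
have := @Rintegral_itvB R f (BLeft a) (BRight c) b (continuous_integrable _ _ cf).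
rewrite !bnd_simp => /(_ ab bc).
rewrite Rintegral_itv_obnd_cbnd; last first.
  apply: integrableS (continuous_integrable b c cf) => //.
  by apply: subset_itvr; rewrite bnd_simp.
by move=> <-; rewrite addrC subrK.
Qed.

Lemma integral_sub_const f a b c e : continuous f -> a <= b ->
  (forall x, a <= x <= b -> `|f x - c| <= e) ->
  `|segint a b f - (b - a) * c| <= (b - a) * e.
Proof.
move=> cf ab fe; rewrite unlock.
have meas : fine (mu `[a, b]) = b - a.
  rewrite lebesgue_measure_itv/= lte_fin.
  by case: ltP => //= ba; rewrite (@le_anti _ _ a b) ?ab// subrr.
have ci k := continuous_integrable a b (fun x => @cst_continuous _ _ k x).
have cstE k : \int[mu]_(x in `[a, b]) k = (b - a) * k.
  by rewrite Rintegral_cst// meas mulrC.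
rewrite -!cstE -(RintegralB _ (continuous_integrable a b cf) (ci c))//.
have cfc : continuous (fun x => f x - c).
  by move=> x; apply: continuousB; [exact: cf|exact: cst_continuous].
apply: (le_trans (le_normr_Rintegral _ _)) => //.
  exact: continuous_integrable.
apply: le_Rintegral => //.
apply: (@continuous_integrable (fun x => `|f x - c|)) => x.
by apply: cvg_norm; exact: cfc.
Qed.

Lemma integral_reflect f a b c : continuous f ->
  segint a b (fun x => f (c - x)) = segint (c - b) (c - a) f.
Proof.
move=> cf; rewrite unlock; have mf := @continuous_measurable f `[c - b, c - a]%classic cf.
rewrite [RHS](Rintegral_subl c (measurable_itv _) mf) preimage_subl_itvcc.
have -> : c - (c - a) = a by ring.
by have -> : c - (c - b) = b by ring.
Qed.

(** A translation is the composition of two reflections. *)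
Lemma integral_translate f a b c : continuous f ->
  segint a b (fun x => f (c + x)) = segint (c + a) (c + b) f.
Proof.
move=> cf.
have cfN : continuous (fun x => f (- x)).
  move=> x; have h : - x' @[x' --> x] --> - x by apply: cvgN; exact: cvg_id.
  exact: (cvg_comp _ _ h (cf (- x))).
have -> : (fun x => f (c + x)) = (fun x => f (- (- c - x))).
  by apply/funext => x; rewrite opprB opprK addrC.
rewrite (integral_reflect a b (- c) cfN).
have -> : (fun x => f (- x)) = (fun x => f (0 - x)).
  by apply/funext => x; rewrite sub0r.
rewrite (integral_reflect (- c - b) (- c - a) 0 cf).
by rewrite !sub0r !opprB !opprK ![_ + c]addrC.
Qed.

End continuous_integrals.

Section increments.
Context {R : realType}.

(** Telescoping over equal steps of length at most eta; the uniform bound on small increments takes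
    the place of a derivative. *)
Lemma small_increments (m : R -> R) (l c : R) : 0 <= l ->
  (forall e, 0 < e -> exists2 eta, 0 < eta & forall x d,
     0 <= x -> 0 <= d <= eta -> x + d <= l -> m (x + d) - m x <= d * (c + e)) ->
  m l - m 0 <= l * c.
Proof.
move=> l0 h; rewrite -subr_le0.
apply: (@ler0_eps_scale _ _ l) => e /andP[e0 _].
have [eta eta0 heta] := h e e0.
pose n := (Num.truncn (l / eta)).+1.
have nl : l / eta < n%:R by rewrite truncnS_gt.
pose d := l / n%:R.
have d0 : 0 <= d by rewrite divr_ge0.
have de : d <= eta by rewrite ler_pdivrMr// mulrC -ler_pdivrMr// ltW.
have nd : n%:R * d = l by rewrite /d mulrC divfK// pnatr_eq0.
have ind (k : nat) : (k <= n)%N -> m (k%:R * d) - m 0 <= k%:R * d * (c + e).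
  elim: k => [|k IH] kn; first by rewrite !mul0r subrr.
  have := IH (ltnW kn).
  have := heta (k%:R * d) d; rewrite mulr_ge0// d0 de => /(_ isT isT).
  rewrite -[X in _ + X <= _ -> _]mul1r -mulrDl natr1 -[X in _ <= X]nd.
  rewrite ler_wpM2r// ?ler_nat// => /(_ isT).
  by rewrite -natr1 mulrDl mul1r; ilra.
by have := ind n (leqnn n); rewrite nd; ilra.
Qed.

Lemma itv_dist_le (a b x eta : R) : a <= x <= b -> b - a <= eta ->
  `|x - a| <= eta /\ `|x - b| <= eta.
Proof.
move=> /andP[ax xb] ab.
by rewrite ger0_norm ?subr_ge0// ler0_norm ?subr_le0//; split; lra.
Qed.

End increments.

(** * Transport along the lines s + t = const *)

Section transport.
Context {R : realType}.
Variables (F : R -> R -> R) (S T T' : R).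
Hypothesis F_unif : forall e, 0 < e -> exists2 eta, 0 < eta &
  forall t t' r r', `|t - t'| <= eta -> `|r - r'| <= eta ->
    `|F t r - F t' r'| <= e.

Lemma unif_continuous_r t : continuous (F t).
Proof.
move=> r; apply/cvgrPdist_le => /= e e0; have [eta eta0 h] := F_unif e0.
near=> r'; apply: h; first by rewrite subrr normr0 ltW.
by near: r'; apply: (@cvgr_dist_le _ _ _ _ _ id).
Unshelve. all: by end_near. Qed.

Lemma unif_continuous_l r : continuous (fun t => F t r).
Proof.
move=> t; apply/cvgrPdist_le => /= e e0; have [eta eta0 h] := F_unif e0.
near=> t'; apply: h; last by rewrite subrr normr0 ltW.
by near: t'; apply: (@cvgr_dist_le _ _ _ _ _ id).
Unshelve. all: by end_near. Qed.

Hypothesis S_ge0 : 0 <= S.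
Hypothesis F_rect : forall t1 t2 r1 r2, 0 <= t1 -> t1 <= t2 -> t2 <= T ->
  0 <= r1 -> r1 <= r2 -> r2 <= T' ->
  `|(segint r1 r2 (F t2) - segint r1 r2 (F t1)) -
    (segint t1 t2 (fun t => F t r2) - segint t1 t2 (fun t => F t r1))|
  <= (t2 - t1) * (r2 - r1) * S.

(* Averaging over a window of width h in the second variable turns the
   rectangle inequality into a bound on the increments along the line
   x |-> (t + x, r - x). *)
Lemma transport_window t r l h : 0 <= t -> 0 <= l -> t + l <= T ->
  0 < h -> 0 <= r - h - l -> r <= T' ->
  `|segint (r - h - l) (r - l) (F (t + l)) - segint (r - h) r (F t)| <=
  l * (h * S).
Proof.
move=> t0 l0 tl h0 rl rT.
pose m x := segint (r - h - x) (r - x) (F (t + x)).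
have step e : 0 < e -> exists2 eta, 0 < eta & forall x d,
    0 <= x -> 0 <= d <= eta -> x + d <= l ->
    `|m (x + d) - m x| <= d * (h * S + e).
  move=> e0; have e4 : 0 < e / 4 by rewrite divr_gt0.
  have [eta eta0 he] := F_unif e4; exists eta => // x d x0 /andP[d0 de] xd.
  set s := t + x; set p := r - x; set q := r - h - x.
  have -> : m (x + d) = segint (q - d) (p - d) (F (s + d)).
    have e1 : r - h - (x + d) = q - d by rewrite /q; ring.
    have e2 : r - (x + d) = p - d by rewrite /p; ring.
    by rewrite /m e1 e2 addrA.
  have -> : m x = segint q p (F s) by exact: erefl.
  have cF := @unif_continuous_r (s + d).
  have qp : q <= p by rewrite /q /p; lra.
  (* The window over [q - d, p - d] is the one over [q, p] plus a strip at q minus a strip at p.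
     These strips cancel the two integrals in the first variable from [F_rect], with an error d e /
     4 for each of the four. *)
  have ch1 := integral_chasles cF (_ : q - d <= q) qp.
  have ch2 := integral_chasles cF (_ : q - d <= p - d) (_ : p - d <= p).
  have {}ch1 := ch1 ltac:(lra); have {}ch2 := ch2 ltac:(lra) ltac:(lra).
  have := F_rect (t1 := s) (t2 := s + d) (r1 := q) (r2 := p).
  rewrite /s addr_ge0// lerDl d0 qp /q /p.
  move=> /(_ isT isT ltac:(lra) ltac:(lra) isT ltac:(lra)).
  rewrite -/s -/p -/q.
  have sd : s <= s + d by rewrite lerDl.
  have A1 := @integral_sub_const R (fun y => F y p) s (s + d) (F s p) (e / 4)
    (@unif_continuous_l p) sd.
  have A2 := @integral_sub_const R (fun y => F y q) s (s + d) (F s q) (e / 4)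
    (@unif_continuous_l q) sd.
  have A3 := @integral_sub_const R (F (s + d)) (p - d) p (F s p) (e / 4) cF.
  have A4 := @integral_sub_const R (F (s + d)) (q - d) q (F s q) (e / 4) cF.
  have sde : s + d - s = d by ring.
  have pde : p - (p - d) = d by ring.
  have qde : q - (q - d) = d by ring.
  have [sdl pdl qdl] : [/\ s + d - s <= eta, p - (p - d) <= eta & q - (q - d) <= eta].
    by rewrite sde pde qde.
  have {}A1 := A1 ltac:(move=> y yI; apply: he;
    [exact: (itv_dist_le yI sdl).1|by rewrite subrr normr0 ltW]).
  have {}A2 := A2 ltac:(move=> y yI; apply: he;
    [exact: (itv_dist_le yI sdl).1|by rewrite subrr normr0 ltW]).
  have sd_eta : `|s + d - s| <= eta by rewrite sde ger0_norm.
  have pd : p - d <= p by rewrite gerBl.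
  have qd : q - d <= q by rewrite gerBl.
  have {}A3 := A3 pd ltac:(move=> y yI; apply: he => //;
    exact: (itv_dist_le yI pdl).2).
  have {}A4 := A4 qd ltac:(move=> y yI; apply: he => //;
    exact: (itv_dist_le yI qdl).2).
  move: A1 A2 A3 A4.
  rewrite sde pde qde.
  have -> : p - q = h by rewrite /p /q; ring.
  rewrite !ler_norml => /andP[a1 a1'] /andP[a2 a2'] /andP[a3 a3'] /andP[a4 a4'].
  move=> /andP[a5 a5'].
  by apply/andP; split; lra.
have -> : segint (r - h) r (F t) = m 0.
  by rewrite /m !subr0 addr0.
rewrite -[X in `|X - _|]/(m l) ler_norml; apply/andP; split.
  rewrite -lerN2 opprK.
  have := @small_increments R (fun x => - m x) l (h * S) l0.
  rewrite opprD; apply => e e0; have [eta eta0 he] := step e e0.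
  exists eta => // x d x0 de xd.
  by have := he x d x0 de xd; rewrite ler_norml => /andP[+ _]; ilra.
apply: small_increments => // e e0; have [eta eta0 he] := step e e0.
exists eta => // x d x0 de xd.
by have := he x d x0 de xd; rewrite ler_norml => /andP[].
Qed.

(** The bound on windows of width h is divided by h; uniform continuity replaces each window by a
    point value as the error e tends to 0. *)
Lemma transport t r l : 0 <= t -> 0 <= l -> t + l <= T -> l <= r -> r <= T' ->
  `|F (t + l) (r - l) - F t r| <= l * S.
Proof.
move=> t0; rewrite le0r => /predU1P[-> *|l0 tl lr rT].
  by rewrite addr0 subr0 subrr normr0 mul0r.
rewrite -subr_le0; apply: (@ler0_eps_scale _ _ 2) => e /andP[e0 _].
have [eta eta0 he] := F_unif e0.
pose h := Num.min eta l.
have h0 : 0 < h by rewrite lt_min eta0.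
have hl : h <= l by rewrite ge_min lexx orbT.
have hh : h <= eta by rewrite ge_min lexx.
(* The displacement is l - h, not l: the lower end of the moved window is then exactly r - l, which
   is nonnegative. *)
have := @transport_window t r (l - h) h t0.
rewrite subr_ge0 hl => /(_ isT ltac:(lra) h0 ltac:(lra) rT).
have -> : r - h - (l - h) = r - l by ring.
have A1 := @integral_sub_const R (F t) (r - h) r (F t r) e
  (@unif_continuous_r t) ltac:(lra).
have A2 := @integral_sub_const R (F (t + (l - h))) (r - l) (r - (l - h))
  (F (t + l) (r - l)) e (@unif_continuous_r _) ltac:(lra).
have {}A1 := A1 ltac:(move=> y /andP[y1 y2]; apply: he;
  [rewrite subrr normr0 ltW//|rewrite ler0_norm; lra]).
have {}A2 := A2 ltac:(move=> y /andP[y1 y2]; apply: he;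
  [rewrite ler0_norm; lra|rewrite ger0_norm; lra]).
move: A1 A2.
have -> : r - (r - h) = h by ring.
have -> : r - (l - h) - (r - l) = h by ring.
have hS : (l - h) * (h * S) <= h * (l * S).
  by have := mulr_ge0 (ltW h0) (mulr_ge0 (ltW h0) S_ge0); ilra.
set X := F (t + l) (r - l); set Y := F t r.
rewrite !ler_norml => /andP[a1 a1'] /andP[a2 a2'] /andP[a3 a3'].
suff : `|X - Y| <= l * S + 2 * e by ilra.
rewrite ler_norml; apply/andP; split; rewrite -(ler_pM2l h0); lra.
Qed.

End transport.

(** * From inequalities on squares to growth bounds *)

Section growth.
Context {R : realType}.
Variables (e : R -> R) (A T : R).
Hypothesis ce : continuous e.
Hypothesis e_ge0 : forall t, 0 <= e t.
Hypothesis A_ge0 : 0 <= A.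
Hypothesis e_rect : forall t h S, 0 <= t -> 0 < h -> t + h <= T ->
  (forall x, t <= x <= t + h -> e x <= S) ->
  segint t (t + h) (fun r => e ((t + h + r) / 2)) -
  segint t (t + h) (fun r => e ((t + r) / 2)) <= A * h ^+ 2 * S.

(** In the variable t + r the hypothesis on squares compares the integrals of one function over two
    adjacent windows of length h. *)
Let E2 x := e (x / 2).

Let cE2 : continuous E2.
Proof.
move=> x; have h : x' / 2 @[x' --> x] --> x / 2.
  by apply: cvgMl; exact: cvg_id.
exact: (cvg_comp _ _ h (@ce (x / 2))).
Qed.

Let E2_near x eps : 0 < eps -> exists2 eta, 0 < eta &
  forall y, `|y - x| <= eta -> `|E2 y - E2 x| <= eps.
Proof.
move=> eps0; have /cvgrPdist_le/(_ _ eps0) := @cE2 x.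
case/nbhs_ballP => eta /= eta0 h; exists (eta / 2); first exact: divr_gt0.
move=> y yx; rewrite distrC; apply: h; rewrite /ball/= distrC.
by apply: (le_lt_trans yx); rewrite gtr_pMr// invf_lt1// ltr1n.
Qed.

Let window_step t h S : 0 <= t -> 0 < h -> t + h <= T ->
  (forall x, t <= x <= t + h -> e x <= S) ->
  segint (2 * t + h) (2 * t + h + h) E2 - segint (2 * t) (2 * t + h) E2
  <= h * (h * (A * S)).
Proof.
move=> t0 h0 tT eS; have := e_rect t0 h0 tT eS.
rewrite (integral_translate t (t + h) (t + h) cE2).
rewrite (integral_translate t (t + h) t cE2).
have -> : t + h + t = 2 * t + h by ring.
have -> : t + h + (t + h) = 2 * t + h + h by ring.
have -> : t + t = 2 * t by ring.
have -> : t + (t + h) = 2 * t + h by ring.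
have -> // : A * h ^+ 2 * S = h * (h * (A * S)) by ring.
Qed.

(** Adjacent windows are telescoped from 2 a to 2 b. Each step costs h^2 A S and there are at most 2
    (b - a) / h steps; division by h gives the bound, up to the oscillation of [E2] on the two
    extreme windows. *)
Lemma increment_le a b S : 0 <= a -> a <= b -> b <= T ->
  (forall x, a <= x <= b -> e x <= S) -> e b - e a <= 2 * A * (b - a) * S.
Proof.
move=> a0 ab bT eS.
have S0 : 0 <= S by rewrite (le_trans (e_ge0 a))// eS// lexx.
move: ab; rewrite le_eqVlt => /predU1P[->|ab]; first by rewrite !subrr mulr0 mul0r.
have [e_b e_a] : e b = E2 (2 * b) /\ e a = E2 (2 * a).
  by rewrite /E2 !(mulrC 2) !mulfK.
rewrite -subr_le0; apply: (@ler0_eps_scale _ _ 2) => eps /andP[eps0 _].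
have [eta1 eta10 h1] := E2_near (2 * a) eps0.
have [eta2 eta20 h2] := E2_near (2 * b) eps0.
have d0 : 0 < 2 * (b - a) by rewrite mulr_gt0// subr_gt0.
pose eta := Num.min eta1 eta2; have eta0 : 0 < eta by rewrite lt_min eta10.
(* The segment [2 a, 2 b] holds n + 1 windows, hence n steps from the first window to the last,
   which starts at 2 b - h. *)
pose n := Num.truncn (2 * (b - a) / eta).
have nl : 2 * (b - a) / eta < n.+1%:R by rewrite truncnS_gt.
pose h := 2 * (b - a) / n.+1%:R.
have h0 : 0 < h by rewrite divr_gt0.
have he : h <= eta by rewrite ler_pdivrMr// [leRHS]mulrC -ler_pdivrMr// ltW.
have nh : n.+1%:R * h = 2 * (b - a) by rewrite /h [LHS]mulrC divfK// pnatr_eq0.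
have hab : n%:R * h + h = 2 * (b - a) by rewrite -nh -natr1 mulrDl mul1r.
have he1 : h <= eta1 by rewrite (le_trans he)// ge_min lexx.
have he2 : h <= eta2 by rewrite (le_trans he)// ge_min lexx orbT.
pose M x := segint x (x + h) E2.
have ind (k : nat) : (k <= n)%N ->
    M (2 * a + k%:R * h) - M (2 * a) <= k%:R * h * (h * (A * S)).
  elim: k => [|k IH] kn; first by rewrite !mul0r addr0 subrr.
  have {}IH := IH (ltnW kn).
  have kn1 : k%:R * h + h <= n%:R * h.
    by rewrite -[X in _ + X]mul1r -mulrDl natr1 ler_wpM2r ?(ltW h0)// ler_nat.
  have k0 : 0 <= k%:R * h by rewrite mulr_ge0// ltW.
  have := @window_step (a + k%:R * h / 2) h S.
  have -> : 2 * (a + k%:R * h / 2) = 2 * a + k%:R * h by field.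
  have kS : k.+1%:R * h = k%:R * h + h by rewrite -natr1 mulrDl mul1r.
  rewrite -/(M _) -/(M _) kS.
  have -> : 2 * a + (k%:R * h + h) = 2 * a + k%:R * h + h by ring.
  move=> /(_ ltac:(clear -a0 k0; lra) h0 ltac:(clear -kn1 hab bT; lra)) st.
  have := st ltac:(move=> x /andP[x1 x2]; apply: eS; apply/andP;
    split; clear -kn1 hab bT k0 x1 x2; lra).
  by move: IH; clear; ilra.
have {ind} := ind n (leqnn n).
have -> : n%:R * h = 2 * (b - a) - h by rewrite -hab addrK.
have -> : 2 * a + (2 * (b - a) - h) = 2 * b - h by ring.
have A1 := @integral_sub_const R E2 (2 * a) (2 * a + h) (E2 (2 * a)) eps cE2
  ltac:(by rewrite lerDl ltW).
have A2 := @integral_sub_const R E2 (2 * b - h) (2 * b - h + h) (E2 (2 * b)) eps cE2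
  ltac:(by rewrite lerDl ltW).
have {}A1 := A1 ltac:(move=> y /andP[y1 y2]; apply: h1;
  rewrite ger0_norm; clear -y1 y2 he1; lra).
have {}A2 := A2 ltac:(move=> y /andP[y1 y2]; apply: h2;
  rewrite ler0_norm; clear -y1 y2 he2; lra).
move: A1 A2; rewrite -/(M (2 * a)) -/(M (2 * b - h)).
have -> : 2 * a + h - 2 * a = h by ring.
have -> : 2 * b - h + h - (2 * b - h) = h by ring.
have AS : (2 * (b - a) - h) * (h * (A * S)) <= h * (2 * (b - a) * (A * S)).
  by have := mulr_ge0 (mulr_ge0 (ltW h0) (ltW h0)) (mulr_ge0 A_ge0 S0); ilra.
rewrite e_b e_a !ler_norml => /andP[_ a1] /andP[a2 _] a3.
by rewrite -(ler_pM2l h0); move: a1 a2 a3 AS; clear; ilra.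
Qed.

(** At a maximum point c of e on [a, b] the increment from a is at most half of e c, so e c <= 2 e
    a. *)
Lemma doubling a b : 0 <= a -> a <= b -> b <= T -> 4 * A * (b - a) <= 1 ->
  e b <= 2 * e a.
Proof.
move=> a0 ab bT small.
have [c cab cmax] := EVT_max ab (@continuous_subspaceT _ _ `[a, b]%classic e ce).
have {}cmax x : a <= x <= b -> e x <= e c by move=> xab; apply: cmax; rewrite in_itv.
move: cab; rewrite in_itv/= => /andP[ac cb].
have := @increment_le a c (e c) a0 ac (le_trans cb bT).
move=> /(_ ltac:(move=> x /andP[x1 x2]; apply: cmax; rewrite x1 (le_trans x2)//)).
have : 2 * A * (c - a) * e c <= 2^-1 * e c.
  rewrite ler_wpM2r//.
  have : A * (c - a) <= A * (b - a) by rewrite ler_wpM2l// lerD2r.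
  by move: small; ilra.
have : e b <= e c by apply: cmax; rewrite ab lexx.
by ilra.
Qed.

(** Doubling over n + 1 steps short enough for [doubling]; the power of 2 plays the role of
    Gronwall's exponential. *)
Lemma growth_bound (n : nat) : 4 * A * T <= n.+1%:R ->
  forall t, 0 <= t <= T -> e t <= 2 ^+ n.+1 * e 0.
Proof.
move=> nT t /andP[t0 tT].
pose d := t / n.+1%:R; have d0 : 0 <= d by rewrite divr_ge0.
have nd : n.+1%:R * d = t by rewrite /d mulrC divfK// pnatr_eq0.
have small : 4 * A * d <= 1.
  rewrite mulrA ler_pdivrMr// mul1r (le_trans _ nT)// ler_wpM2l//.
  by rewrite mulr_ge0.
suff ind (k : nat) : (k <= n.+1)%N -> e (k%:R * d) <= 2 ^+ k * e 0.
  by rewrite -nd ind.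
elim: k => [|k IH] kn; first by rewrite mul0r expr0 mul1r.
have k0 : 0 <= k%:R * d by rewrite mulr_ge0.
have le_d : k%:R * d <= k.+1%:R * d by rewrite ler_wpM2r// ler_nat.
have le_t : k.+1%:R * d <= T by rewrite (le_trans _ tT)// -nd ler_wpM2r// ler_nat.
have diff : k.+1%:R * d - k%:R * d = d by rewrite -natr1 mulrDl mul1r addrAC subrr add0r.
have := doubling k0 le_d le_t; rewrite diff => /(_ small) /le_trans; apply.
by rewrite exprS -mulrA ler_wpM2l// IH// ltnW.
Qed.

End growth.

(** * Weak solutions in a semi-inner product space *)

Section bounded_curves.
Context {R : realType} {E : lmodType R} (B : E -> E -> R).
Hypothesis siB : semi_inner B.
Local Notation nrm := (fnorm B).
Local Notation mu := (@lebesgue_measure R).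
Implicit Types (u w : R -> E) (a b : E -> E).

(** Curves live on the whole line; those given on [0, T] are extended by clamping the time. *)
Definition unif_curve u := forall e, 0 < e -> exists2 eta, 0 < eta &
  forall s t, `|s - t| <= eta -> nrm (u s - u t) <= e.

(** The model is multiplication by a potential of L^oo-norm at most A. *)
Definition bounded_form_op (A : R) a :=
  (forall x y, B (a x) y = B x (a y)) /\
  (forall x y, `|B (a x) y| <= A * nrm x * nrm y).

Lemma unif_curve_form u w M M' : unif_curve u -> unif_curve w ->
  (forall t, nrm (u t) <= M) -> (forall t, nrm (w t) <= M') ->
  forall e, 0 < e -> exists2 eta, 0 < eta & forall t t' r r',
    `|t - t'| <= eta -> `|r - r'| <= eta ->
    `|B (u t) (w r) - B (u t') (w r')| <= e.
Proof.
move=> uu uw uM wM e e0.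
have M0 : 0 <= M by apply: le_trans (uM 0); exact: fnorm_ge0.
have M'0 : 0 <= M' by apply: le_trans (wM 0); exact: fnorm_ge0.
have d0 : 0 < M + M' + 1 by rewrite ltr_wpDl// addr_ge0.
have e'0 : 0 < e / (M + M' + 1) by rewrite divr_gt0.
have [eta1 eta10 h1] := uu _ e'0; have [eta2 eta20 h2] := uw _ e'0.
exists (Num.min eta1 eta2) => [|t t' r r']; first by rewrite lt_min eta10.
rewrite !le_min => /andP[/h1 tt _] /andP[_ /h2 rr].
have -> : B (u t) (w r) - B (u t') (w r') =
    B (u t - u t') (w r) + B (u t') (w r - w r').
  by rewrite (formBl siB) (formBr siB); ring.
have F1 := form_le siB (u t - u t') (w r).
have F2 := form_le siB (u t') (w r - w r').
have F3 := ler_pM (fnorm_ge0 B _) (fnorm_ge0 B _) tt (wM r).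
have F4 := ler_pM (fnorm_ge0 B _) (fnorm_ge0 B _) (uM t') rr.
rewrite (le_trans (ler_normD _ _))//.
have -> : e = e / (M + M' + 1) * M' + M * (e / (M + M' + 1)) + e / (M + M' + 1).
  by field; rewrite gt_eqF.
apply: (@le_trans _ _ (e / (M + M' + 1) * M' + M * (e / (M + M' + 1)))).
  by rewrite lerD// (le_trans _ F3, le_trans _ F4).
by rewrite lerDl ltW.
Qed.

Lemma unif_curve_cst x : unif_curve (fun=> x).
Proof. by move=> e e0; exists 1 => // s t _; rewrite subrr (fnorm0 siB) ltW. Qed.

Lemma continuous_curve_form u M x : unif_curve u -> (forall t, nrm (u t) <= M) ->
  continuous (fun t => B (u t) x).
Proof.
move=> uu uM.
have h := unif_curve_form uu (@unif_curve_cst x) uM (fun=> lexx (nrm x)).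
exact: (@unif_continuous_l _ (fun t r => B (u t) x) h 0).
Qed.

Lemma Rintegral_oo_le (f : R -> R) c s t : s <= t ->
  measurable_fun (`]s, t[ : set (measurableTypeR R)) f ->
  (forall x, s < x < t -> `|f x| <= c) ->
  mu.-integrable `]s, t[ (EFin \o f) /\
  `|\int[mu]_(x in `]s, t[) f x| <= (t - s) * c.
Proof.
move=> st mf fc.
have mfin : (mu `]s, t[ < +oo)%E.
  by rewrite lebesgue_measure_itv/= lte_fin; case: ifP => _; rewrite ?ltry.
have meas : fine (mu `]s, t[) = t - s.
  rewrite lebesgue_measure_itv/= lte_fin.
  by case: ltP => //= ts; rewrite (@le_anti _ _ s t) ?st// subrr.
have fint : mu.-integrable `]s, t[ (EFin \o f).
  apply: measurable_bounded_integrable => //.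
  exists c; split; first exact: num_real.
  move=> k ck x /=; rewrite in_itv/= => /fc fx.
  by rewrite (le_trans fx)// ltW.
split => //; apply: (le_trans (le_normr_Rintegral _ fint)) => //.
rewrite -meas mulrC -(Rintegral_cst mu (measurable_itv _)).
apply: le_Rintegral => //.
  exact: (integrable_abse fint).
apply: measurable_bounded_integrable => //.
by exists `|c|; split; [exact: num_real|move=> k ck x _; exact: ltW].
Qed.

Lemma bounded_weak_curve u M s t : s <= t ->
  (forall x, measurable_fun (`]s, t[ : set (measurableTypeR R)) (fun r => B (u r) x)) ->
  (forall r, s < r < t -> nrm (u r) <= M) ->
  weak_curve B mu `]s, t[ u ((t - s) * M).
Proof.
move=> st mu_ uM; split => // f mf fu.
have fM x : s < x < t -> `|f x| <= M.
  move=> xst; have := fu x; rewrite /= in_itv/= => /(_ xst) /andP[f0 fn].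
  by rewrite ger0_norm// (le_trans fn)// uM.
have [fint fle] := Rintegral_oo_le st mf fM.
have f0 : (0 <= \int[mu]_(x in `]s, t[) (f x)%:E)%E.
  by apply: integral_ge0 => x /fu /andP[]; rewrite lee_fin.
rewrite -(fineK (integrable_fin_num _ fint))//= lee_fin.
by apply: le_trans fle; exact: ler_norm.
Qed.

Lemma weak_curve_sub d (X : measurableType d) (nu : {measure set X -> \bar R})
    (I J : set X) (G : X -> E) C : measurable I -> measurable J -> J `<=` I ->
  weak_curve B nu I G C -> weak_curve B nu J G C.
Proof.
move=> mI mJ JI [mG wG]; split => [x|f mf fG].
  exact: measurable_funS (mG x).
have -> : (\int[nu]_(x in J) (f x)%:E = \int[nu]_(x in I) ((f \_ J) x)%:E)%E.
  rewrite -[in LHS](setIidr JI) integral_mkcondr.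
  by apply: eq_integral => x _; rewrite !patchE; case: ifP.
apply: wG => [|x Ix].
  by apply: measurable_funS measurableT _ _ => //; apply/(measurable_restrictT _ _).1.
rewrite patchE; case: ifPn => [/[!inE]|_]; first exact: fG.
by rewrite lexx fnorm_ge0.
Qed.

End bounded_curves.

Lemma Rintegral_sum d (X : measurableType d) (R : realType)
    (mu : {measure set X -> \bar R}) (D : set X) (I : Type) (s : seq I)
    (f : I -> X -> R) :
  measurable D -> (forall i, mu.-integrable D (EFin \o f i)) ->
  \int[mu]_(x in D) (\sum_(i <- s) f i x) = \sum_(i <- s) \int[mu]_(x in D) f i x.
Proof.
move=> mD fint; elim: s => [|i s IH].
  rewrite big_nil; under eq_Rintegral do rewrite big_nil.
  by rewrite Rintegral_cst// mul0r.
rewrite big_cons -IH; under eq_Rintegral do rewrite big_cons.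
apply: RintegralD => //.
have -> : EFin \o (fun x => \sum_(j <- s) f j x) =
    (fun x => \sum_(j <- s) (f j x)%:E)%E.
  by apply/funext => x /=; rewrite -sumEFin.
by apply: integrable_sum => // j _; exact: fint.
Qed.

Lemma segint_oo (R : realType) (f : R -> R) a b : continuous f ->
  segint a b f = \int[@lebesgue_measure R]_(x in `]a, b[) f x.
Proof.
move=> cf; have fint := continuous_integrable a b cf.
rewrite unlock Rintegral_itv_obnd_cbnd; last first.
  by apply: integrableS fint => //; exact: subset_itv_oo_cc.
rewrite Rintegral_itv_bndo_bndc//.
by apply: integrableS fint => //; apply: subset_itvl; rewrite bnd_simp.
Qed.

Section weak_solutions.
Context {R : realType} {E : lmodType R} (B : E -> E -> R).
Hypothesis siB : semi_inner B.
Local Notation nrm := (fnorm B).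
Local Notation mu := (@lebesgue_measure R).
Local Notation mean s t u := (weak_mean B mu `]s, t[ u).
Variables (n : nat) (W : E -> ('I_n -> E) -> Prop).
Implicit Types (a b : E -> E) (u w : R -> E) (g k : R -> 'I_n -> E).

(* [W v h] reads: v is an admissible test function with gradient h. *)
Record weak_solution_with a (T : R) u g (C M : R) : Prop := WeakSolution {
  wsol_unif : unif_curve B u ;
  wsol_bound : forall t, nrm (u t) <= M ;
  wsol_grad : \forall t \ae mu, 0 < t < T -> W (u t) (g t) ;
  wsol_wc : forall i, weak_curve B mu `]0, T[ (g^~ i) C ;
  wsol_eq : forall v h, W v h -> forall s t, 0 <= s -> s <= t -> t <= T ->
    B (u t) v - B (u s) v =
    mean s t (fun r => a (u r)) v - \sum_(i < n) mean s t (g^~ i) (h i) }.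

Definition weak_solution a T u := exists g C M, weak_solution_with a T u g C M.

Lemma wsol_continuous a T u g C M : weak_solution_with a T u g C M ->
  forall x, continuous (fun t => B (u t) x).
Proof.
move=> usol x; apply: (continuous_curve_form siB (M := M)).
  exact: wsol_unif usol.
exact: wsol_bound usol.
Qed.
Arguments wsol_continuous {a T u g C M} _ x.

Section rectangles.
Variables (a b : E -> E) (A A' T T' C C' M M' : R) (u w : R -> E).
Variables (g k : R -> 'I_n -> E).
Hypothesis aA : bounded_form_op B A a.
Hypothesis bA : bounded_form_op B A' b.
Hypothesis usol : weak_solution_with a T u g C M.
Hypothesis wsol : weak_solution_with b T' w k C' M'.

Lemma sub_time_weak_curve s t i : 0 <= s -> t <= T ->
  weak_curve B mu `]s, t[ (g^~ i) C.
Proof.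
move=> s0 tT; apply: (weak_curve_sub _ _ _ (wsol_wc usol i)) => //.
by apply: subset_itvW.
Qed.

Lemma measurable_potential_form s t x :
  measurable_fun (`]s, t[ : set (measurableTypeR R)) (fun r => B (a (u r)) x).
Proof.
have -> : (fun r => B (a (u r)) x) = (fun r => B (u r) (a x)).
  by apply/funext => r; exact: aA.1.
by apply: continuous_measurable; exact: wsol_continuous usol _.
Qed.

Lemma weak_curve_sol s t N : s <= t -> (forall r, s < r < t -> nrm (u r) <= N) ->
  weak_curve B mu `]s, t[ u ((t - s) * N).
Proof.
move=> st uN; apply: bounded_weak_curve => // x.
by apply: continuous_measurable; exact: wsol_continuous usol _.
Qed.

Lemma weak_curve_potential s t : 0 <= A -> s <= t ->
  weak_curve B mu `]s, t[ (fun r => a (u r)) ((t - s) * (A * M)).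
Proof.
move=> A0 st; apply: bounded_weak_curve => // [x|r _].
  exact: measurable_potential_form.
apply: (fnorm_le siB) => [|y].
  by rewrite mulr_ge0// (le_trans (fnorm_ge0 B _) (wsol_bound usol 0)).
apply: (le_trans (aA.2 _ _)); rewrite ler_wpM2r ?fnorm_ge0// ler_wpM2l//.
exact: wsol_bound usol r.
Qed.

(** The equation of u over (t1, t2) is tested with w r and integrated in r. *)
Lemma half_rectangle t1 t2 r1 r2 : 0 <= A ->
  0 <= t1 -> t1 <= t2 -> t2 <= T -> 0 <= r1 -> r1 <= r2 -> r2 <= T' ->
  segint r1 r2 (fun r => B (u t2) (w r)) - segint r1 r2 (fun r => B (u t1) (w r)) =
  \int[mu]_(r in `]r1, r2[) mean t1 t2 (fun t => a (u t)) (w r) -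
  \sum_(i < n) \int[mu]_(r in `]r1, r2[) mean t1 t2 (g^~ i) (k r i).
Proof.
move=> A0 t10 t12 t2T r10 r12 r2T.
have mJ : measurable (`]r1, r2[ : set (measurableTypeR R)) by [].
have mI : measurable (`]t1, t2[ : set (measurableTypeR R)) by [].
have cF t : continuous (fun r => B (u t) (w r)).
  have -> : (fun r => B (u t) (w r)) = (fun r => B (w r) (u t)).
    by apply/funext => r; exact: formC.
  exact: wsol_continuous wsol _.
have wcw : weak_curve B mu `]r1, r2[ w ((r2 - r1) * M').
  apply: bounded_weak_curve => // [x|r _]; last exact: wsol_bound wsol r.
  by apply: continuous_measurable; exact: wsol_continuous wsol _.
have wck i : weak_curve B mu `]r1, r2[ (k^~ i) C'.
  apply: (weak_curve_sub _ _ _ (wsol_wc wsol i)) => //.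
  by apply: subset_itvW.
have wcg i := sub_time_weak_curve i t10 t2T.
have wca := weak_curve_potential A0 t12.
have int1 i := (weak_mean_comp siB mI (wcg i) mJ (wck i)).1.
have int2 := (weak_mean_comp siB mI wca mJ wcw).1.
have ints : mu.-integrable `]r1, r2[
    (EFin \o (fun r => \sum_(i < n) mean t1 t2 (g^~ i) (k r i))).
  have -> : EFin \o (fun r => \sum_(i < n) mean t1 t2 (g^~ i) (k r i)) =
    (fun r => \sum_(i < n) (mean t1 t2 (g^~ i) (k r i))%:E)%E.
    by apply/funext => x /=; rewrite -sumEFin.
  by apply: integrable_sum => // i _; exact: int1.
have cint t : mu.-integrable `]r1, r2[ (EFin \o (fun r => B (u t) (w r))).
  apply: integrableS (continuous_integrable r1 r2 (@cF t)) => //.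
  exact: subset_itv_oo_cc.
rewrite !segint_oo; [|exact: cF|exact: cF].
rewrite -Rintegral_sum//.
rewrite -(RintegralB mJ (cint t2) (cint t1)) -(RintegralB mJ int2 ints).
rewrite /Rintegral; congr fine; apply: ae_eq_integral => //.
- apply/measurable_EFinP.
  by apply: measurable_funB; exact: continuous_measurable.
- apply/measurable_EFinP; apply: measurable_funB.
    by apply/measurable_EFinP; exact: measurable_int int2.
  by apply/measurable_EFinP; exact: measurable_int ints.
(* For almost every r in (0, T') the vector w r is an admissible test function with gradient k r. *)
have := wsol_grad wsol; apply: (@filterS _ _ (ae_filter_ringOfSetsType mu)).
move=> r hr /=; rewrite in_itv/= => /andP[h1 h2].
congr EFin; apply: (wsol_eq usol) => //; apply: hr.
by rewrite (le_lt_trans r10)// (lt_le_trans h2).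
Qed.

End rectangles.
End weak_solutions.

Lemma eq_segint (R : realType) (f g : R -> R) a b :
  (forall x, a <= x <= b -> f x = g x) -> segint a b f = segint a b g.
Proof.
move=> fg; rewrite unlock; apply: eq_Rintegral => x; rewrite inE/= in_itv/=.
exact: fg.
Qed.

(** * Duality, comparison and energy estimates for weak solutions *)

Section estimates.
Context {R : realType} {E : lmodType R} (B : E -> E -> R).
Hypothesis siB : semi_inner B.
Local Notation nrm := (fnorm B).
Local Notation mu := (@lebesgue_measure R).
Local Notation mean s t u := (weak_mean B mu `]s, t[ u).
Variables (n : nat) (W : E -> ('I_n -> E) -> Prop).
Implicit Types (a b : E -> E) (u w : R -> E).

Section two_solutions.
Variables (a b : E -> E) (A A' T T' : R) (u w : R -> E) (kappa N N' : R).
Hypothesis A0 : 0 <= A.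
Hypothesis A'0 : 0 <= A'.
Hypothesis aA : bounded_form_op B A a.
Hypothesis bA : bounded_form_op B A' b.
Hypothesis usol : weak_solution B W a T u.
Hypothesis wsol : weak_solution B W b T' w.
Hypothesis ab : forall x y, `|B (a x) y - B (b x) y| <= kappa * nrm x * nrm y.
Hypothesis kappa0 : 0 <= kappa.
Hypothesis uN : forall t, 0 <= t <= T -> nrm (u t) <= N.
Hypothesis wN : forall t, 0 <= t <= T' -> nrm (w t) <= N'.

(* The gradient terms of the two half rectangles cancel by [weak_fubini]. *)
Lemma rectangle t1 t2 r1 r2 :
  0 <= t1 -> t1 <= t2 -> t2 <= T -> 0 <= r1 -> r1 <= r2 -> r2 <= T' ->
  `|(segint r1 r2 (fun r => B (u t2) (w r)) -
     segint r1 r2 (fun r => B (u t1) (w r))) -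
    (segint t1 t2 (fun t => B (u t) (w r2)) -
     segint t1 t2 (fun t => B (u t) (w r1)))|
  <= (t2 - t1) * (r2 - r1) * (kappa * N * N').
Proof.
move=> t10 t12 t2T r10 r12 r2T.
have [g [C [M us]]] := usol; have [k [C' [M' ws]]] := wsol.
rewrite (half_rectangle siB aA us ws A0 t10 t12 t2T r10 r12 r2T).
have swap r : (fun t => B (u t) (w r)) = (fun t => B (w r) (u t)).
  by apply/funext => t; exact: formC.
rewrite !swap (half_rectangle siB bA ws us A'0 r10 r12 r2T t10 t12 t2T).
have mI : measurable (`]t1, t2[ : set (measurableTypeR R)) by [].
have mJ : measurable (`]r1, r2[ : set (measurableTypeR R)) by [].
have wcg i := sub_time_weak_curve us i t10 t2T.
have wck i := sub_time_weak_curve ws i r10 r2T.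
have -> : \sum_(i < n) \int[mu]_(r in `]r1, r2[) mean t1 t2 (g^~ i) (k r i) =
    \sum_(i < n) \int[mu]_(t in `]t1, t2[) mean r1 r2 (k^~ i) (g t i).
  by apply: eq_bigr => i _; exact: (weak_fubini siB mI (wcg i) mJ (wck i)).
have wcu : weak_curve B mu `]t1, t2[ u ((t2 - t1) * M).
  by apply: (weak_curve_sol siB us) => // r _; exact: wsol_bound us r.
have wcw : weak_curve B mu `]r1, r2[ w ((r2 - r1) * M').
  by apply: (weak_curve_sol siB ws) => // r _; exact: wsol_bound ws r.
have wcau := weak_curve_potential siB aA us A0 t12.
have wcbw := weak_curve_potential siB bA ws A'0 r12.
rewrite (weak_fubini siB mJ wcbw mI wcu).
have int1 := (weak_mean_comp siB mI wcau mJ wcw).1.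
have int2 := (weak_mean_comp siB mI wcu mJ wcbw).1.
set I1 := \int[mu]_(r in `]r1, r2[) mean t1 t2 (fun t => a (u t)) (w r).
set I2 := \int[mu]_(r in `]r1, r2[) mean t1 t2 u (b (w r)).
set S := \sum_(i < n) _.
(* What remains is a double integral of <a u, w> - <u, b w>; the symmetry of b makes it a difference
   of potentials, bounded pointwise by kappa N N'. *)
have -> : I1 - S - (I2 - S) = I1 - I2 by ring.
rewrite /I1 /I2 -(RintegralB mJ int1 int2).
rewrite mulrAC mulrC.
apply: (Rintegral_oo_le r12 _ _).2 => [|r /andP[h1 h2]].
  apply: measurable_funB; apply/measurable_EFinP.
    exact: measurable_int int1.
  exact: measurable_int int2.
have intau := weak_curve_form siB mI wcau (w r).
have intu := weak_curve_form siB mI wcu (b (w r)).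
rewrite /weak_mean -(RintegralB mI intau intu).
apply: (Rintegral_oo_le t12 _ _).2 => [|t /andP[h3 h4]].
  apply: measurable_funB; apply/measurable_EFinP.
    exact: measurable_int intau.
  exact: measurable_int intu.
rewrite -bA.1 (le_trans (ab _ _))//.
rewrite -!mulrA ler_wpM2l// ler_pM ?fnorm_ge0//.
  by apply: uN; rewrite (le_trans t10 (ltW h3)) (le_trans (ltW h4)).
by apply: wN; rewrite (le_trans r10 (ltW h1)) (le_trans (ltW h2)).
Qed.

Lemma transport_sol t r l : 0 <= t -> 0 <= l -> t + l <= T -> l <= r -> r <= T' ->
  `|B (u (t + l)) (w (r - l)) - B (u t) (w r)| <= l * (kappa * N * N').
Proof.
move=> t0 l0 tl lr rT.
have [g [C [M us]]] := usol; have [k [C' [M' ws]]] := wsol.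
apply: (@transport R (fun t r => B (u t) (w r)) _ T T') => //.
- apply: (unif_curve_form siB (wsol_unif us) (wsol_unif ws)).
    exact: wsol_bound us.
  exact: wsol_bound ws.
- have N0 : 0 <= N.
    apply: le_trans (fnorm_ge0 B (u t)) (uN _).
    by rewrite t0 (le_trans _ tl)// lerDl.
  have N'0 : 0 <= N'.
    apply: le_trans (fnorm_ge0 B (w r)) (wN _).
    by rewrite rT (le_trans l0).
  by rewrite !mulr_ge0.
- exact: rectangle.
Qed.

End two_solutions.

Section energy.
Variables (a : E -> E) (A T : R) (u : R -> E).
Hypothesis A0 : 0 <= A.
Hypothesis aA : bounded_form_op B A a.
Hypothesis usol : weak_solution B W a T u.

(** With equal potentials kappa is 0 and <u(t), u(r)> is constant along t + r = const, so both times
    can be moved to their midpoint. *)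
Lemma diagonal t r : 0 <= t <= T -> 0 <= r <= T ->
  B (u t) (u r) = nrm (u ((t + r) / 2)) ^+ 2.
Proof.
wlog tr : t r / t <= r => [hw tT rT|/andP[t0 tT] /andP[r0 rT]].
  have [/hw|/ltW rt] := leP t r; first exact.
  by rewrite (formC siB) (addrC t) hw.
have [g [C [M us]]] := usol.
have bM t' : 0 <= t' <= T -> nrm (u t') <= M by move=> _; exact: wsol_bound us t'.
have := @transport_sol a a A A T T u u 0 M M A0 A0 aA aA usol usol.
have zero x y : `|B (a x) y - B (a x) y| <= 0 * nrm x * nrm y.
  by rewrite subrr normr0 !mul0r.
move=> /(_ zero (lexx _) bM bM t r ((r - t) / 2) t0).
move=> /(_ ltac:(lra) ltac:(lra) ltac:(lra) rT).
have -> : t + (r - t) / 2 = (t + r) / 2 by field.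
have -> : r - (r - t) / 2 = (t + r) / 2 by field.
by rewrite !mul0r mulr0 normr_le0 subr_eq0 (sqr_fnorm siB) => /eqP.
Qed.

Lemma continuous_sqr_fnorm_sol : continuous (fun t => nrm (u t) ^+ 2).
Proof.
have [g [C [M us]]] := usol.
have un := unif_curve_form siB (wsol_unif us) (wsol_unif us)
  (wsol_bound us) (wsol_bound us).
move=> t; apply/cvgrPdist_le => /= e e0; have [eta eta0 h] := un e e0.
near=> t'; rewrite !(sqr_fnorm siB).
have tt' : `|t - t'| <= eta by near: t'; apply: (@cvgr_dist_le _ _ _ _ _ id).
exact: h.
Unshelve. all: by end_near. Qed.

(** By [diagonal] the left side is a difference of integrals of <u(s), u(r)>, to which
    [half_rectangle] applies with w = u on a square. The gradient terms are double means, hence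
    nonnegative, and enter with a minus sign; only the potential term is left. *)
Lemma energy_rect t h S : 0 <= t -> 0 < h -> t + h <= T ->
  (forall x, t <= x <= t + h -> nrm (u x) ^+ 2 <= S) ->
  segint t (t + h) (fun r => nrm (u ((t + h + r) / 2)) ^+ 2) -
  segint t (t + h) (fun r => nrm (u ((t + r) / 2)) ^+ 2) <= A * h ^+ 2 * S.
Proof.
move=> t0 h0 thT uS; have th : t <= t + h by rewrite lerDl ltW.
have [g [C [M us]]] := usol.
have S0 : 0 <= S by rewrite (le_trans (sqr_ge0 (nrm (u t))))// uS// lexx.
have diag s : 0 <= s <= T -> segint t (t + h) (fun r => nrm (u ((s + r) / 2)) ^+ 2) =
    segint t (t + h) (fun r => B (u s) (u r)).
  move=> sT; apply: eq_segint => x /andP[tx xt]; rewrite diagonal//.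
  by rewrite (le_trans t0 tx) (le_trans xt).
rewrite !diag ?t0 ?(le_trans th) ?thT ?(le_trans t0 th)//.
rewrite (half_rectangle siB aA us us A0 t0 th thT t0 th thT).
have mI : measurable (`]t, t + h[ : set (measurableTypeR R)) by [].
have wcg i := sub_time_weak_curve us i t0 thT.
have sum_ge0 : 0 <= \sum_(i < n) \int[mu]_(r in `]t, (t + h)[) mean t (t + h) (g^~ i) (g r i).
  by apply: sumr_ge0 => i _; exact: (weak_double_mean_ge0 siB mI (wcg i)).
have wcau := weak_curve_potential siB aA us A0 th.
have wcu : weak_curve B mu `]t, t + h[ u ((t + h - t) * M).
  by apply: (weak_curve_sol siB us) => // r _; exact: wsol_bound us r.
have int1 := (weak_mean_comp siB mI wcau mI wcu).1.
have hh : t + h - t = h by ring.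
apply: (le_trans (y := \int[mu]_(r in `]t, (t + h)[)
    mean t (t + h) (fun s => a (u s)) (u r))); first by rewrite gerBl.
have -> : A * h ^+ 2 * S = h * (h * (A * S)) by ring.
have bound r s : t < r < t + h -> t < s < t + h -> `|B (a (u s)) (u r)| <= A * S.
  move=> /andP[r1 r2] /andP[s1 s2]; apply: (le_trans (aA.2 _ _)).
  rewrite -mulrA ler_wpM2l//.
  have er : nrm (u r) ^+ 2 <= S by apply: uS; rewrite !ltW.
  have es : nrm (u s) ^+ 2 <= S by apply: uS; rewrite !ltW.
  have := sqr_ge0 (nrm (u s) - nrm (u r)); rewrite sqrrB => sq.
  by rewrite -(@ler_pM2l _ 2)//; lra.
have inner r : t < r < t + h -> `|mean t (t + h) (fun s => a (u s)) (u r)| <= h * (A * S).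
  move=> rth; rewrite -{2}hh; apply: (Rintegral_oo_le th _ _).2 => [|s]; last exact: bound.
  by apply/measurable_EFinP; exact: measurable_int (weak_curve_form siB mI wcau (u r)).
rewrite (le_trans (ler_norm _))// -{3}hh.
apply: (Rintegral_oo_le th _ inner).2.
by apply/measurable_EFinP; exact: measurable_int int1.
Qed.

Lemma energy_bound (m : nat) : 4 * A * T <= m.+1%:R ->
  forall t, 0 <= t <= T -> nrm (u t) ^+ 2 <= 2 ^+ m.+1 * nrm (u 0) ^+ 2.
Proof.
move=> mT t tT.
apply: (growth_bound continuous_sqr_fnorm_sol _ A0 energy_rect mT tT) => s.
exact: sqr_ge0.
Qed.

End energy.
End estimates.

(** * Time reversal *)

Section reversal.
Context {R : realType} {E : lmodType R} (B : E -> E -> R).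
Hypothesis siB : semi_inner B.
Local Notation nrm := (fnorm B).
Local Notation mu := (@lebesgue_measure R).
Local Notation mean s t u := (weak_mean B mu `]s, t[ u).

Lemma ae_subl (c : R) (P : R -> Prop) :
  (\forall t \ae mu, P t) -> \forall t \ae mu, P (c - t).
Proof.
move=> [A [mA A0 PA]]; exists ((fun x => c - x) @^-1` A); split.
- by rewrite -[X in measurable X]setTI; exact: measurable_subl.
- by have := lebesgue_measure_subl c mA; rewrite A0 => /esym.
- by move=> x /= Px; apply: PA.
Qed.

Lemma weak_curve_subl (c s t : R) (G : R -> E) C :
  weak_curve B mu `]c - t, c - s[ G C ->
  weak_curve B mu `]s, t[ (fun r => G (c - r)) C.
Proof.
have pre : (fun x => c - x) @^-1` `]c - t, c - s[%classic = `]s, t[%classic.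
  rewrite preimage_subl_itvoo; have -> : c - (c - s) = s by ring.
  by have -> : c - (c - t) = t by ring.
have pre' : (fun x => c - x) @^-1` `]s, t[%classic = `]c - t, c - s[%classic.
  exact: preimage_subl_itvoo.
have comp (f : R -> R) (I J : set R) : (fun x => c - x) @^-1` J = I ->
    measurable (J : set (measurableTypeR R)) ->
    measurable_fun (J : set (measurableTypeR R)) f ->
    measurable_fun (I : set (measurableTypeR R)) (fun r => f (c - r)).
  move=> <- mJ mf; apply: (measurable_comp mJ _ mf); last first.
    by apply: measurable_funTS; exact: measurable_subl.
  by move=> _ [x Jx <-].
move=> [mG wG]; split => [x|f mf fG].
  exact: comp pre _ (mG x).
have f0 x : (`]s, t[%classic : set R) x -> (0 <= (f x)%:E)%E.
  by move=> /fG /andP[]; rewrite lee_fin.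
rewrite (@ge0_integral_subl _ c)//; last exact/measurable_EFinP.
rewrite pre'; apply: (wG (fun x => f (c - x))) => [|x].
  exact: comp pre' _ mf.
rewrite /= in_itv/= => /andP[h1 h2]; have := fG (c - x).
have -> : c - (c - x) = x by ring.
apply; rewrite /= in_itv/=; apply/andP; split; lra.
Qed.

Lemma weak_mean_subl (c s t : R) (G : R -> E) x :
  measurable_fun (`]c - t, c - s[ : set (measurableTypeR R)) (fun r => B (G r) x) ->
  mean s t (fun r => G (c - r)) x = mean (c - t) (c - s) G x.
Proof.
move=> mG; rewrite /weak_mean (@Rintegral_subl _ c _ (fun r => B (G r) x))//.
rewrite preimage_subl_itvoo; have -> : c - (c - s) = s by ring.
by have -> : c - (c - t) = t by ring.
Qed.

Variables (n : nat) (W : E -> ('I_n -> E) -> Prop).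

(** The assumed equation is the backward one over (s, t), with the increment of u taken backwards;
    the reflection of time restores the forward sign. *)
Lemma reverse_solution (a : E -> E) (A T : R) (u : R -> E) (g : R -> 'I_n -> E)
    (C M : R) :
  bounded_form_op B A a -> unif_curve B u -> (forall t, nrm (u t) <= M) ->
  (\forall t \ae mu, 0 < t < T -> W (u t) (g t)) ->
  (forall i, weak_curve B mu `]0, T[ (g^~ i) C) ->
  (forall v h, W v h -> forall s t, 0 <= s -> s <= t -> t <= T ->
    B (u s) v - B (u t) v =
    mean s t (fun r => a (u r)) v - \sum_(i < n) mean s t (g^~ i) (h i)) ->
  weak_solution_with B W a T (fun t => u (T - t)) (fun t => g (T - t)) C M.
Proof.
move=> aA uu uM ug wg ueq; split => //.
- move=> e e0; have [eta eta0 h] := uu e e0; exists eta => // s t st; apply: h.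
  have -> : T - s - (T - t) = t - s by ring.
  by rewrite distrC.
- have := ae_subl T ug; apply: (@filterS _ _ (ae_filter_ringOfSetsType mu)).
  by move=> t h /andP[t0 tT]; apply: h; apply/andP; split; lra.
- move=> i; apply: (@weak_curve_subl T 0 T (g^~ i)).
  by rewrite subrr subr0; exact: wg.
move=> v h Wvh s t s0 st tT.
have Tt : 0 <= T - t by rewrite subr_ge0.
have Tts : T - t <= T - s by rewrite lerD2l lerN2.
have Ts : T - s <= T by rewrite lerBlDr lerDl.
rewrite (ueq v h Wvh _ _ Tt Tts Ts); congr (_ - _).
  rewrite -(@weak_mean_subl T s t (fun r => a (u r)))//.
  have -> : (fun r => B (a (u r)) v) = (fun r => B (u r) (a v)).
    by apply/funext => r; exact: aA.1.
  apply: continuous_measurable.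
  exact: (continuous_curve_form siB uu uM).
apply: eq_bigr => i _; rewrite -(@weak_mean_subl T s t (g^~ i))//.
apply: measurable_funS ((wg i).1 (h i)) => //.
by apply: subset_itvW.
Qed.

End reversal.

(** * Extension of curves beyond [0, T] *)

Section clamping.
Context {R : realType}.
Implicit Types (T t : R).

Definition clamp T t := Num.max 0 (Num.min t T).

Lemma clamp_itv T t : 0 <= T -> 0 <= clamp T t <= T.
Proof. by move=> T0; rewrite /clamp le_max lexx/= ge_max T0 ge_min lexx orbT. Qed.

Lemma clamp_id T t : 0 <= t <= T -> clamp T t = t.
Proof.
by move=> /andP[t0 tT]; rewrite /clamp (min_idPl tT); exact/max_idPr.
Qed.

Lemma clamp_dist T s t : 0 <= T -> `|clamp T s - clamp T t| <= `|s - t|.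
Proof.
move=> T0; rewrite /clamp.
have h1 := ler_norm (s - t); have h2 := ler_norm (t - s).
rewrite distrC in h2; have h3 := normr_ge0 (s - t); move: `|s - t| h1 h2 h3 => d.
move=> h1 h2 h3; case: (leP s T) => sT; case: (leP t T) => tT; case: (leP 0 s) => s0;
  case: (leP 0 t) => t0; rewrite ?(max_r T0) ?subrr ?normr0//;
  rewrite ler_norml; apply/andP; split; lra.
Qed.

Context {E : lmodType R} (B : E -> E -> R).
Hypothesis siB : semi_inner B.

(** Heine's theorem: the set of admissible moduli is handled by the near-covering form of
    compactness. The bound is the maximum of the continuous norm on [0, T]. *)
Lemma clamp_unif_curve T (u : R -> E) : 0 < T ->
  (forall t, 0 <= t <= T -> forall e, 0 < e -> exists2 eta, 0 < eta &
    forall s, 0 <= s <= T -> `|s - t| <= eta -> fnorm B (u s - u t) <= e) ->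
  unif_curve B (fun t => u (clamp T t)) /\
  exists M, forall t, fnorm B (u (clamp T t)) <= M.
Proof.
move=> T0 cu.
have unif e : 0 < e -> exists2 eta, 0 < eta & forall t s, 0 <= t <= T ->
    0 <= s <= T -> `|s - t| <= eta -> fnorm B (u s - u t) <= e.
  move=> e0; have e2 : 0 < e / 2 by rewrite divr_gt0.
  have /compact_near_coveringP cov := @segment_compact R 0 T.
  pose P (eta : R) (t : R) := 0 <= t <= T -> forall s, 0 <= s <= T ->
    `|s - t| <= eta -> fnorm B (u s - u t) <= e.
  have : \forall eta \near 0^'+, `[0, T]%classic `<=` P eta.
    apply: (cov R (0^'+) P) => t; rewrite /= in_itv/= => tT.
    have [eta eta0 h] := cu t tT _ e2.
    have eta2 : 0 < eta / 2 by rewrite divr_gt0.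
    exists (ball t (eta / 2), [set x | x <= eta / 2]) => /=.
      split; first exact: nbhsx_ballx.
      by near=> x; near: x; exact: nbhs_right_le.
    move=> [t' d] /= [tt' de] t'T s sT st'.
    have t't : `|t' - t| <= eta / 2 by rewrite distrC ltW.
    have A1 := h t' t'T; have A2 := h s sT.
    have -> : e = e / 2 + e / 2 by field.
    rewrite (le_trans (fnorm_triangle siB (u t) _ _))// lerD//.
      apply: A2; have -> : s - t = (s - t') + (t' - t) by ring.
      have -> : eta = eta / 2 + eta / 2 by field.
      by rewrite (le_trans (ler_normD _ _))// lerD// (le_trans st').
    rewrite (fnormBC siB) A1// (le_trans t't)// ler_pdivrMr// ler_peMr ?(ltW eta0)//.
    by rewrite ler1n.
  move=> /nbhs_ballP[r /= r0 hr].
  exists (r / 2); first by rewrite divr_gt0.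
  move=> t s tT sT st; apply: (hr (r / 2) _ _ t) => //=.
  - rewrite /ball/= sub0r normrN gtr0_norm ?divr_gt0//.
    by rewrite ltr_pdivrMr// ltr_pMr// ltr1n.
  - by rewrite divr_gt0.
have clampT t := clamp_itv t (ltW T0).
have uu : unif_curve B (fun t => u (clamp T t)).
  move=> e e0; have [eta eta0 h] := unif e e0; exists eta => // s t st.
  by apply: h => //; rewrite (le_trans (clamp_dist _ _ (ltW T0))).
split => //.
have cn : continuous (fun t => fnorm B (u (clamp T t))).
  move=> t; apply/cvgrPdist_le => /= e e0; have [eta eta0 h] := uu e e0.
  near=> t'.
  have tt' : `|t - t'| <= eta by near: t'; apply: (@cvgr_dist_le _ _ _ _ _ id).
  by rewrite (le_trans (ler_dist_fnorm siB _ _))// h.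
have [c _ cmax] := EVT_max (ltW T0) (@continuous_subspaceT _ _ `[0, T]%classic _ cn).
exists (fnorm B (u (clamp T c))) => t.
by have := cmax (clamp T t); rewrite (clamp_id (clampT t)) in_itv => -> //; exact: clampT.
Unshelve. all: by end_near. Qed.

End clamping.

(** * The space L^2(D) *)

Section L2_space.
Context {R : realType} {N : nat}.
Local Notation V := 'rV[R]_N.
Local Notation leb := (leb_rV R N).
Implicit Types (D : set V) (u v : V -> R).

Lemma L2_closed D : submod_closed (fun u : V -> R => u \_ D \in Lfun leb 2%:E).
Proof.
have p1 : (1 <= 2%:E :> \bar R)%E by rewrite lee1n.
have [L0 Llin] := Lfun_submod_closed leb p1.
split => [|c u v uL vL]; rewrite unfold_in.
  suff -> : (0 : V -> R) \_ D = 0 by [].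
  by apply/funext => x; rewrite patchE; case: ifP.
have -> : (c *: u + v) \_ D = c *: (u \_ D) + v \_ D.
  apply/funext => x; rewrite /= !fctE !patchE; case: ifP => // _.
  by rewrite scaler0 addr0.
exact: Llin.
Qed.

Definition L2pred D : {pred V -> R} := fun u => u \_ D \in Lfun leb 2%:E.

HB.instance Definition _ D :=
  GRing.isSubmodClosed.Build R (V -> R) (L2pred D) (L2_closed D).

Definition L2space D := {u : V -> R | u \in L2pred D}.
HB.instance Definition _ D := SubType.on (L2space D).
HB.instance Definition _ D := [Choice of L2space D by <:].
HB.instance Definition _ D := [SubChoice_isSubLmodule of L2space D by <:].

(** Functions outside L^2(D) are sent to 0, so that a curve becomes total in time. *)
Definition toL2 D u : L2space D := insubd 0 u.

Lemma val_toL2 D u : L2 D u -> val (toL2 D u) = u.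
Proof. by move=> uL; rewrite /toL2 insubdK. Qed.

Lemma L2_val D (f : L2space D) : L2 D (val f).
Proof. exact: valP f. Qed.

Definition L2form D (f g : L2space D) : R := innerL2 D (val f) (val g).

End L2_space.

Section L2_form.
Context {R : realType} {N : nat}.
Local Notation V := 'rV[R]_N.
Local Notation leb := (leb_rV R N).
Implicit Types (D : set V) (u v w : V -> R).

Lemma restrictM D u v : (u \* v) \_ D = (u \_ D) \* (v \_ D).
Proof.
by apply/funext => x /=; rewrite !patchE; case: ifP => // _; rewrite mulr0.
Qed.

Lemma innerL2E D u v : innerL2 D u v = \int[leb]_x ((u \_ D) x * (v \_ D) x).
Proof. by rewrite /innerL2 Rintegral_mkcond restrictM. Qed.

Lemma L2_mul_integrable D u v : L2 D u -> L2 D v ->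
  leb.-integrable setT (EFin \o ((u \_ D) \* (v \_ D))).
Proof. by move=> uL vL; apply/Lfun1_integrable/Lfun2_mul_Lfun1. Qed.

Lemma innerL2C D u v : innerL2 D u v = innerL2 D v u.
Proof. by rewrite /innerL2; under eq_Rintegral do rewrite mulrC. Qed.

Lemma innerL2_ge0 D u : 0 <= innerL2 D u u.
Proof. by apply: Rintegral_ge0 => x _; rewrite -expr2 sqr_ge0. Qed.

Lemma innerL2_lin D c u v w : L2 D u -> L2 D v -> L2 D w ->
  innerL2 D (c *: u + v) w = c * innerL2 D u w + innerL2 D v w.
Proof.
move=> uL vL wL; rewrite !innerL2E.
have iu := L2_mul_integrable uL wL; have iv := L2_mul_integrable vL wL.
have ciu : leb.-integrable setT
    (EFin \o (fun x => c * ((u \_ D) x * (w \_ D) x))).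
  exact: (integrableZl measurableT c iu).
rewrite -(RintegralZl c measurableT iu) -(RintegralD measurableT ciu iv).
apply: eq_Rintegral => x _; rewrite /= !patchE; case: ifP => _.
  by rewrite (_ : (c *: u + v) x = c * u x + v x)// mulrDl mulrA.
(* Outside D the restrictions take the default value [point], which is 0. *)
by rewrite -[point]/(0 : R) !mul0r mulr0 addr0.
Qed.

Lemma L2form_semi_inner D : semi_inner (@L2form R N D).
Proof.
split => [c f g h|f g|f]; rewrite /L2form.
- by rewrite linearP innerL2_lin//; exact: L2_val.
- exact: innerL2C.
- exact: innerL2_ge0.
Qed.

(** When the square has infinite integral, [fine] sends both sides to 0. *)
Lemma normL2E D u : normL2 D u = Num.sqrt (innerL2 D u u).
Proof.
rewrite /normL2 unlock /Lnorm innerL2E /Rintegral.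
have -> : (\int[leb]_x ((u \_ D) x * (u \_ D) x)%:E =
    \int[leb]_x `|(EFin \o u \_ D) x| `^ 2)%E.
  by apply: eq_integral => x _; rewrite /= powR_mulrn// real_normK ?num_real// expr2.
have : (0 <= \int[leb]_x `|(EFin \o u \_ D) x| `^ 2)%E.
  by apply: integral_ge0 => x _; exact: poweR_ge0.
case: (\int[leb]_x _)%E => [r| |]//= r0.
  by rewrite powR12_sqrt// -lee_fin.
by rewrite invr_eq0 pnatr_eq0/= sqrtr0.
Qed.

Lemma fnorm_L2form D (f : L2space D) : fnorm (@L2form R N D) f = normL2 D (val f).
Proof. by rewrite normL2E. Qed.

Lemma normL2_sub D u v : L2 D u -> L2 D v ->
  normL2 D (u \- v) = fnorm (@L2form R N D) (toL2 D u - toL2 D v).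
Proof. by move=> uL vL; rewrite fnorm_L2form raddfB/= !val_toL2. Qed.

Lemma innerL2_toL2 D u v : L2 D u -> L2 D v ->
  innerL2 D u v = L2form (toL2 D u) (toL2 D v).
Proof. by move=> uL vL; rewrite /L2form !val_toL2. Qed.

Lemma normL2_toL2 D u : L2 D u -> normL2 D u = fnorm (@L2form R N D) (toL2 D u).
Proof. by move=> uL; rewrite fnorm_L2form val_toL2. Qed.

(* If the Lebesgue measure of the whole space were zero, the library's
   L^oo-norm would be zero: this degenerate case is handled separately. *)
Lemma normLinfty_ae D u c : (normLinfty D u <= c%:E)%E ->
  \forall x \ae leb, `|(u \_ D) x| <= c.
Proof.
rewrite /normLinfty unlock /Lnorm; case: ifPn => [_|mu0 _].
  move=> /ess_supP; apply: (@filterS _ _ (ae_filter_ringOfSetsType leb)).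
  by move=> x /=; rewrite lee_fin.
apply: measure0_ae; apply/eqP; rewrite eq_le measure_ge0 andbT leNgt.
exact: mu0.
Qed.

(** The almost everywhere bound on b is squared and integrated. It serves potentials and, with b an
    indicator function, the restriction to a subset. *)
Lemma L2_potential D b u c : measurable_fun setT (b \_ D) -> 0 <= c ->
  (normLinfty D b <= c%:E)%E -> L2 D u ->
  L2 D (b \* u) /\ normL2 D (b \* u) <= c * normL2 D u.
Proof.
move=> mb c0 bc uL.
have mu' : measurable_fun setT (u \_ D).
  by have /andP[/[!inE]] := uL.
have mbu : measurable_fun setT ((b \* u) \_ D).
  by rewrite restrictM; exact: measurable_funM.
have usq := L2_mul_integrable uL uL.
have le_sq : (\int[leb]_x (((b \* u)%R \_ D) x ^+ 2)%:E <=
    \int[leb]_x (c ^+ 2 * ((u \_ D) x * (u \_ D) x))%:E)%E.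
  apply: ae_ge0_le_integral => //.
  - by move=> x _; rewrite lee_fin sqr_ge0.
  - by apply/measurable_EFinP; exact: measurable_funX.
  - by move=> x _; rewrite lee_fin mulr_ge0 ?sqr_ge0// -expr2 sqr_ge0.
  - by apply/measurable_EFinP; apply: measurable_funM => //; exact: measurable_funM.
  have := normLinfty_ae bc; apply: (@filterS _ _ (ae_filter_ringOfSetsType leb)).
  move=> x bx _; rewrite lee_fin restrictM exprMn -expr2 ler_wpM2r ?sqr_ge0//.
  by rewrite -(ger0_norm (sqr_ge0 _)) normrX ler_pXn2r// ?nnegrE.
have csq : leb.-integrable setT
    (EFin \o (fun x => c ^+ 2 * ((u \_ D) x * (u \_ D) x))).
  exact: (integrableZl measurableT (c ^+ 2) usq).
have buL : L2 D (b \* u).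
  apply/andP; split; first by rewrite inE/=.
  rewrite inE/= /finite_norm unlock /Lnorm poweR_lty//.
  have -> : (\int[leb]_x `|(EFin \o (b \* u)%R \_ D) x| `^ 2 =
      \int[leb]_x (((b \* u)%R \_ D) x ^+ 2)%:E)%E.
    by apply: eq_integral => x _; rewrite /= powR_mulrn// real_normK ?num_real.
  apply: (le_lt_trans le_sq).
  have /integrableP[_] := csq; congr (_ < _)%E.
  apply: eq_integral => x _; rewrite /= ger0_norm//.
  by apply: mulr_ge0; rewrite -?expr2; exact: sqr_ge0.
split => //; rewrite !normL2E.
rewrite -(ger0_norm c0) -sqrtr_sqr -sqrtrM ?sqr_ge0// ler_wsqrtr//.
rewrite !innerL2E -(RintegralZl _ measurableT usq).
rewrite -lee_fin /Rintegral fineK; last first.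
  exact: (integrable_fin_num measurableT (L2_mul_integrable buL buL)).
rewrite fineK; last exact: (integrable_fin_num measurableT csq).
by under eq_integral do rewrite -expr2.
Qed.

End L2_form.

(** * Multiplication by a bounded potential *)

Section potential.
Context {R : realType} {N : nat}.
Local Notation V := 'rV[R]_N.
Local Notation leb := (leb_rV R N).
Variable D : set V.
Implicit Types (a b : V -> R) (f g : L2space D).
Local Notation B := (@L2form R N D).

Definition potential a f : L2space D := toL2 D (a \* val f).

Lemma Linfty_measurable a : Linfty D a -> measurable_fun setT (a \_ D).
Proof. by move=> /andP[/[!inE]]. Qed.

Lemma Linfty_bound a : Linfty D a ->
  exists2 A, 0 <= A & (normLinfty D a <= A%:E)%E.
Proof.
move=> /andP[_]; rewrite inE/= /finite_norm -/(normLinfty D a) => afin.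
have a0 : (0 <= normLinfty D a)%E by exact: Lnorm_ge0.
exists (fine (normLinfty D a)); first exact: fine_ge0.
by rewrite fineK// ge0_fin_numE.
Qed.

Lemma L2_mul_Linfty a f : Linfty D a -> L2 D (a \* val f).
Proof.
move=> aL; have [A A0 aA] := Linfty_bound aL.
exact: (L2_potential (Linfty_measurable aL) A0 aA (L2_val f)).1.
Qed.

Lemma potential_form a f g : Linfty D a ->
  B (potential a f) g = innerL2 D (a \* val f) (val g).
Proof. by move=> aL; rewrite /L2form val_toL2//; exact: L2_mul_Linfty. Qed.

Lemma potential_bounded a A : Linfty D a -> 0 <= A ->
  (normLinfty D a <= A%:E)%E -> bounded_form_op B A (potential a).
Proof.
move=> aL A0 aA; split => f g.
  rewrite (formC (L2form_semi_inner D) f) !potential_form//.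
  by rewrite /innerL2; apply: eq_Rintegral => x _ /=; ring.
apply: (le_trans (form_le (L2form_semi_inner D) _ _)).
rewrite ler_wpM2r ?fnorm_ge0// -normL2_toL2; last exact: L2_mul_Linfty.
rewrite fnorm_L2form.
exact: (L2_potential (Linfty_measurable aL) A0 aA (L2_val f)).2.
Qed.

Lemma potential_sub_le a b k f g : Linfty D a -> Linfty D b -> 0 <= k ->
  (normLinfty D (a \- b)%R <= k%:E)%E ->
  `|B (potential a f) g - B (potential b f) g| <= k * fnorm B f * fnorm B g.
Proof.
move=> aL bL k0 abk.
have mab : measurable_fun setT ((a \- b) \_ D).
  have -> : (a \- b) \_ D = (a \_ D) \- (b \_ D).
    apply/funext => x /=; rewrite !patchE; case: ifP => // _.
    by rewrite subrr.
  by apply: measurable_funB; exact: Linfty_measurable.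
have [abL abf] := L2_potential mab k0 abk (L2_val f).
have -> : B (potential a f) g - B (potential b f) g =
    innerL2 D ((a \- b) \* val f) (val g).
  rewrite !potential_form// !innerL2E.
  rewrite -(RintegralB measurableT (L2_mul_integrable (L2_mul_Linfty _ aL) (L2_val g))
    (L2_mul_integrable (L2_mul_Linfty _ bL) (L2_val g))).
  apply: eq_Rintegral => x _; rewrite /= !patchE; case: ifP => _ /=; first by ring.
  by rewrite -[point]/(0 : R) !mul0r subrr.
rewrite (innerL2_toL2 abL (L2_val g)).
apply: (le_trans (form_le (L2form_semi_inner D) _ _)).
have -> : toL2 D (val g) = g by apply: val_inj; rewrite val_toL2//; exact: L2_val.
rewrite ler_wpM2r ?fnorm_ge0// -normL2_toL2//.
by rewrite fnorm_L2form.
Qed.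

End potential.

(** * Open sets and restriction to a subdomain *)

Section subdomain.
Context {R : realType} {N : nat}.
Local Notation V := 'rV[R]_N.
Local Notation leb := (leb_rV R N).
Implicit Types (D O : set V) (u v : V -> R).

(** The sigma-algebra is generated by the coordinates, so an open set is written as a countable
    union of boxes with rational centres. *)
Lemma open_measurable_rV O : open O -> measurable (O : set V).
Proof.
move=> oO.
pose box (c : 'rV[rat]_N * nat) : set V :=
  [set x | forall i, `|x ord0 i - ratr (c.1 ord0 i)| < c.2.+1%:R^-1].
have mbox c : measurable (box c).
  have -> : box c = \bigcap_(i in [set: 'I_N]) [set x : V |
      `|x ord0 i - ratr (c.1 ord0 i)| < c.2.+1%:R^-1].
    by apply/seteqP; split => x /= h i; [move=> _; exact: h|exact: h].
  apply: fin_bigcap_measurable => [|i _]; first exact: finite_finset.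
  pose q : R := ratr (c.1 ord0 i); pose r : R := c.2.+1%:R^-1.
  have -> : [set x : V | `|x ord0 i - q| < r] =
      setT `&` (fun x : V => x ord0 i : measurableTypeR R) @^-1` `]q - r, q + r[%classic.
    apply/seteqP; split => x /=; rewrite in_itv/= ltr_distl.
      by move=> ->.
    by case.
  by apply: measurable_coord.
have -> : O = \bigcup_(c in [set c | box c `<=` O]) box c.
  apply/seteqP; split => [x Ox|x [c /= cO]]; last exact: cO.
  have /nbhs_ballP[e /= e0 xe] : nbhs x O by exact: open_nbhs_nbhs.
  (* The half-width 1 / (n + 1) is below e / 2, so a box that contains x lies in the ball of radius
     e around x. *)
  pose n := Num.truncn (2 / e).
  have n0 : 0 < n.+1%:R :> R by [].
  have ne : n.+1%:R^-1 < e / 2.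
    rewrite -[e / 2]invrK ltf_pV2 ?posrE// ?invr_gt0 ?divr_gt0//.
    by rewrite invf_div truncnS_gt.
  have q_ex i : exists q : rat, `|x ord0 i - ratr q| < n.+1%:R^-1.
    have := @rat_in_itvoo R (x ord0 i - n.+1%:R^-1) (x ord0 i + n.+1%:R^-1).
    rewrite ltrD2l gtrN ?invr_gt0// => /(_ isT) [q]; rewrite in_itv/= => hq.
    by exists q; rewrite distrC ltr_distl.
  have [q hq] := choice q_ex.
  exists (\row_i q i, n) => /=; last by move=> i; rewrite mxE; exact: hq.
  move=> z zb; apply: xe; split => // i j; rewrite /ball/= (ord1 i).
  have h1 := hq j; have := zb j; rewrite mxE/= => h2.
  have -> : x ord0 j - z ord0 j = (x ord0 j - ratr (q j)) - (z ord0 j - ratr (q j)).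
    by ring.
  rewrite (le_lt_trans (ler_normB _ _))//.
  by rewrite (splitr e); apply: ltrD; [exact: lt_trans h1 ne|exact: lt_trans h2 ne].
rewrite bigcup_mkcond; apply: countable_bigcupT_measurable => [|c].
  exact: countableP.
by case: ifP => _; [exact: mbox|exact: measurable0].
Qed.

Lemma L2_subdomain D O u : measurable (O : set V) -> O `<=` D -> L2 D u ->
  L2 O u /\ normL2 O u <= normL2 D u.
Proof.
move=> mO OD uL; pose b : V -> R := \1_O.
have bE : b \_ D = b.
  apply/funext => x; rewrite patchE; case: ifPn => // xD.
  rewrite /b indicE; case: (boolP (x \in O)) => // /set_mem /OD xD'.
  by move: xD; rewrite notin_setE.
have buE : (b \* u) \_ D = u \_ O.
  rewrite restrictM bE; apply/funext => x /=; rewrite !patchE /b indicE.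
  case: (boolP (x \in O)) => xO; last by rewrite mul0r.
  by rewrite mul1r; case: ifPn => //; rewrite notin_setE => nD; case: nD; apply/OD/set_mem.
have mb : measurable_fun setT (b \_ D) by rewrite bE; exact: measurable_indic.
have b1 : (normLinfty D b <= 1%:E)%E.
  rewrite /normLinfty unlock /Lnorm; case: ifPn => _; last by rewrite lee_fin.
  apply/ess_supP/nearW => x /=; rewrite bE lee_fin /b indicE.
  by case: (x \in O); rewrite ?normr1 ?normr0.
have [buL] := L2_potential mb ler01 b1 uL.
rewrite mul1r /normL2 buE => bu_le; split => //.
by move: buL; rewrite /L2 buE.
Qed.

Lemma subform_semi_inner D O : measurable (O : set V) -> O `<=` D ->
  semi_inner (fun f g : L2space D => innerL2 O (val f) (val g)).
Proof.
move=> mO OD; split => [c f g h|f g|f].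
- by rewrite linearP innerL2_lin//; exact: (L2_subdomain mO OD (L2_val _)).1.
- exact: innerL2C.
- exact: innerL2_ge0.
Qed.

End subdomain.

(** * From parabolic equations to weak solutions *)

(* Unlike the library's version, no measurability is assumed: the integral of a
   nonnegative function is a supremum over simple functions. *)
Lemma ge0_le_integral_sup d (X : measurableType d) (R : realType)
    (mu : {measure set X -> \bar R}) (D : set X) (f1 f2 : X -> \bar R) :
  (forall x, D x -> 0 <= f1 x)%E -> (forall x, D x -> f1 x <= f2 x)%E ->
  (\int[mu]_(x in D) f1 x <= \int[mu]_(x in D) f2 x)%E.
Proof.
move=> f10 f12; have f20 x : D x -> (0 <= f2 x)%E.
  by move=> Dx; rewrite (le_trans (f10 x Dx))// f12.
rewrite !ge0_integralE//; apply: ereal_sup_le => _ [h /= hf <-].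
exists h => //= x; apply: (le_trans (hf x)).
by rewrite !patchE; case: ifPn => // /set_mem; exact: f12.
Qed.

Lemma Rintegral_oo_split (R : realType) (f : R -> R) a b c :
  (@lebesgue_measure R).-integrable `]a, c[ (EFin \o f) -> a <= b -> b <= c ->
  \int[@lebesgue_measure R]_(x in `]a, c[) f x =
  \int[@lebesgue_measure R]_(x in `]a, b[) f x +
  \int[@lebesgue_measure R]_(x in `]b, c[) f x.
Proof.
move=> fint ab; rewrite le_eqVlt => /predU1P[<-|bc].
  by rewrite [X in _ = _ + X](_ : _ = 0) ?addr0// set_itv_ge ?Rintegral_set0// bnd_simp ltxx.
have := @Rintegral_itvB R f (BRight a) (BLeft c) b fint.
rewrite !bnd_simp => /(_ ab bc) <-.
rewrite -Rintegral_itv_bndo_bndc; first by rewrite addrC subrK.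
apply: integrableS fint => //.
by apply: subset_itvl; rewrite bnd_simp ltW.
Qed.

Section conversion.
Context {R : realType} {N : nat}.
Local Notation V := 'rV[R]_N.
Local Notation mu := (@lebesgue_measure R).
Variable D : set V.
Local Notation B := (@L2form R N D).
Let siB := L2form_semi_inner D.

Definition H10_rel (v : L2space D) (h : 'I_N -> L2space D) :=
  H10 D (val v) (fun i => val (h i)).

Variables (T : R) (y : R -> V -> R) (g : R -> 'I_N -> V -> R).
Hypothesis T0 : 0 < T.
Hypothesis yE : energy_class D T y g.

Let u t := toL2 D (y t).
Let G t i := toL2 D (g t i).

Let yL2 t : 0 <= t <= T -> L2 D (y t).
Proof. by have [+ _ _ _ _] := yE; move=> h tT; apply: h; rewrite in_itv. Qed.

Let gL2 t i : 0 < t < T -> L2 D (g t i).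
Proof. by have [_ _ _ + _] := yE; move=> h tT; apply: h; rewrite in_itv. Qed.

Lemma energy_class_curve :
  unif_curve B (fun t => u (clamp T t)) /\
  exists M, forall t, fnorm B (u (clamp T t)) <= M.
Proof.
apply: clamp_unif_curve => // t tT e e0.
have [_ + _ _ _] := yE; move=> /(_ t); rewrite in_itv/= => /(_ tT).
move=> /cvgrPdist_le/(_ e e0) /nbhs_ballP[eta /= eta0 h].
exists (eta / 2) => [|s sT st]; first exact: divr_gt0.
have := h s; rewrite /ball/= distrC => /(_ _).
have lt_eta : `|s - t| < eta.
  by rewrite (le_lt_trans st)// gtr_pMr// invf_lt1// ltr1n.
move=> /(_ lt_eta); rewrite in_itv/= => /(_ sT).
by rewrite sub0r normrN normL2_sub ?yL2// ger0_norm ?fnorm_ge0.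
Qed.

Lemma energy_class_gradient :
  \forall t \ae mu, 0 < t < T -> H10_rel (u (clamp T t)) (G t).
Proof.
have [_ _ + _ _] := yE; apply: (@filterS _ _ (ae_filter_ringOfSetsType mu)).
move=> t /= + tT; rewrite in_itv/= => /(_ tT).
have tT' : 0 <= t <= T by case/andP: tT => t0 t1; rewrite !ltW.
rewrite /H10_rel clamp_id// /u val_toL2 ?yL2//.
suff -> : (fun i => val (G t i)) = g t by [].
by apply/funext => i; rewrite /G val_toL2// gL2.
Qed.

(** The inequality f <= 1 + f^2 turns square integrability in time into a bound for minorants f of
    |g|. [ge0_le_integral_sup] compares f^2 with |g|^2, whose measurability in time is not
    established. *)
Lemma energy_class_weak_curve i : exists C, weak_curve B mu `]0, T[ (G^~ i) C.
Proof.
have [_ _ _ _ /(_ i) [mg gfin]] := yE.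
pose c := (\int[mu]_(t in `]0%R, T[) (normL2 D (g t i) ^+ 2)%:E)%E.
rewrite -/c in gfin.
have c0 : (0 <= c)%E by apply: integral_ge0 => t _; rewrite lee_fin sqr_ge0.
exists (T + fine c); split => [x|f mf fG].
  apply: eq_measurable_fun (mg (val x) (L2_val x)) => t.
  by rewrite inE/= in_itv/= => tT; rewrite /L2form /G val_toL2// gL2.
rewrite EFinD fineK ?ge0_fin_numE//.
have f0 t : `]0, T[%classic t -> 0 <= f t by move=> /fG/andP[].
apply: (@le_trans _ _ (\int[mu]_(t in `]0%R, T[) (1 + (f t ^+ 2)%:E))%E).
  apply: ge0_le_integral_sup => t tT; first by rewrite lee_fin f0.
  by rewrite -EFinD lee_fin; have := sqr_ge0 (f t - 1); inra.
rewrite ge0_integralD//.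
- apply: leeD.
    rewrite integral_cst// mul1e [leLHS](lebesgue_measure_itv `]0%R, T[)/=.
    by rewrite lte_fin T0 -EFinB subr0.
  apply: ge0_le_integral_sup => t tT; first by rewrite lee_fin sqr_ge0.
  have /andP[h0 h1] := fG t tT.
  have {}h1 : f t <= normL2 D (g t i).
    by rewrite normL2_toL2//; apply: gL2; move: tT; rewrite /= in_itv.
  by rewrite lee_fin ler_pXn2r// nnegrE (le_trans h0).
- by move=> t _; rewrite lee_fin sqr_ge0.
- by apply/measurable_EFinP; exact: measurable_funX.
Qed.

Lemma energy_class_weak_curves :
  exists C, forall i, weak_curve B mu `]0, T[ (G^~ i) C.
Proof.
have [C hC] := choice energy_class_weak_curve.
have C0 i : 0 <= C i by exact: weak_curve_bound_ge0 (hC i).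
exists (\sum_i C i) => i; split; first exact: (hC i).1.
move=> f mf fG; apply: (le_trans ((hC i).2 f mf fG)).
by rewrite lee_fin (bigD1 i)//= lerDl sumr_ge0.
Qed.

Variables (a : V -> R).
Hypothesis aL : Linfty D a.

Let flux (h : 'I_N -> L2space D) r := \sum_(i < N) innerL2 D (g r i) (val (h i)).
Let source (v : L2space D) r := innerL2 D (a \* y r) (val v).

Let fluxE h s t : 0 <= s -> t <= T ->
  mu.-integrable `]s, t[ (EFin \o flux h) /\
  \int[mu]_(r in `]s, t[) flux h r =
  \sum_(i < N) weak_mean B mu `]s, t[ (G^~ i) (h i).
Proof.
move=> s0 tT; have [C wc] := energy_class_weak_curves.
have mI : measurable (`]s, t[ : set (measurableTypeR R)) by [].
have wci i : weak_curve B mu `]s, t[ (G^~ i) C.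
  by apply: weak_curve_sub (wc i) => //; exact: subset_itvW.
have int i := weak_curve_form siB mI (wci i) (h i).
have eqr r : r \in (`]s, t[%classic : set R) ->
    flux h r = \sum_(i < N) B (G r i) (h i).
  rewrite inE/= in_itv/= => /andP[h1 h2]; apply: eq_bigr => i _.
  rewrite /L2form /G val_toL2// gL2//.
  by rewrite (le_lt_trans s0)// (lt_le_trans h2).
split; last first.
  transitivity (\int[mu]_(r in `]s, t[) \sum_(i < N) B (G r i) (h i)).
    exact: eq_Rintegral.
  by rewrite Rintegral_sum.
apply: (@eq_integrable _ _ _ mu _ mI (fun r => \sum_(i < N) (B (G r i) (h i))%:E)%E).
  by move=> r rI; rewrite /= eqr// sumEFin.
exact: integrable_sum.
Qed.

Let sourceE v s t : 0 <= s -> s <= t -> t <= T ->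
  mu.-integrable `]s, t[ (EFin \o source v) /\
  \int[mu]_(r in `]s, t[) source v r =
  weak_mean B mu `]s, t[ (fun r => potential a (u (clamp T r))) v.
Proof.
move=> s0 st tT; have [uu [M uM]] := energy_class_curve.
have [A A0 aA] := Linfty_bound aL.
have pA := potential_bounded aL A0 aA.
have cont : continuous (fun r => B (potential a (u (clamp T r))) v).
  have -> : (fun r => B (potential a (u (clamp T r))) v) =
      (fun r => B (u (clamp T r)) (potential a v)).
    by apply/funext => r; exact: pA.1.
  exact: (continuous_curve_form siB uu uM).
have eqr r : r \in (`]s, t[%classic : set R) ->
    source v r = B (potential a (u (clamp T r))) v.
  rewrite inE/= in_itv/= => /andP[h1 h2].
  have rT : 0 <= r <= T by rewrite (le_trans s0 (ltW h1)) (le_trans (ltW h2)).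
  by rewrite potential_form// clamp_id// /u val_toL2// yL2.
split; last exact: eq_Rintegral.
apply: (@eq_integrable _ _ _ mu _ _ (fun r => (B (potential a (u (clamp T r))) v)%:E)) => //.
  by move=> r rI; rewrite /= eqr.
apply: integrableS (continuous_integrable s t cont) => //.
exact: subset_itv_oo_cc.
Qed.

Let cancel_integrals (p q c i1 i2 i3 i4 : R) :
  q + i1 = c + i2 -> p + (i1 + i3) = c + (i2 + i4) -> p - q = i4 - i3.
Proof. by move=> h1 h2; lra. Qed.

(** Subtracting the equations at times s and t eliminates [c v], which stands for the pairing with
    the initial datum. *)
Lemma forward_weak_solution (c : (V -> R) -> R) :
  (forall v h, H10 D v h -> forall t, t \in `[0, T] ->
    innerL2 D (y t) v +
      \int[mu]_(s in `]0, t[) (\sum_(i < N) innerL2 D (g s i) (h i)) =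
    c v + \int[mu]_(s in `]0, t[) innerL2 D (a \* y s) v) ->
  weak_solution B H10_rel (potential a) T (fun t => u (clamp T t)).
Proof.
move=> eq_y; have [uu [M uM]] := energy_class_curve.
have [C wc] := energy_class_weak_curves.
exists G, C, M; split => //; first exact: energy_class_gradient.
move=> v h vh s t s0 st tT.
have t0 := le_trans s0 st; have sT := le_trans st tT.
have sT' : 0 <= s <= T by rewrite s0.
have tT' : 0 <= t <= T by rewrite t0.
have := eq_y _ _ vh t; have := eq_y _ _ vh s.
rewrite !in_itv/= s0 sT t0 tT => /(_ isT) eqs /(_ isT) eqt.
have [fi _] := fluxE h (lexx 0) tT; have [_ fe] := fluxE h s0 tT.
have [si _] := sourceE v (lexx 0) t0 tT; have [_ se] := sourceE v s0 st tT.
rewrite -fe -se; move: eqs eqt.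
rewrite -/(source v) -/(flux h) (Rintegral_oo_split fi s0 st).
rewrite (Rintegral_oo_split si s0 st) (clamp_id sT') (clamp_id tT').
rewrite {1 2}/L2form /u (val_toL2 (yL2 sT')) (val_toL2 (yL2 tT')).
set i1 := \int[mu]_(r in `]0, s[) _; set i2 := \int[mu]_(r in `]0, s[) _.
set i3 := \int[mu]_(r in `]s, t[) _; set i4 := \int[mu]_(r in `]s, t[) _.
exact: cancel_integrals.
Qed.

Lemma backward_weak_solution (c : (V -> R) -> R) :
  (forall v h, H10 D v h -> forall t, t \in `[0, T] ->
    innerL2 D (y t) v +
      \int[mu]_(s in `]t, T[) (\sum_(i < N) innerL2 D (g s i) (h i)) =
    c v + \int[mu]_(s in `]t, T[) innerL2 D (a \* y s) v) ->
  weak_solution B H10_rel (potential a) T (fun t => u (clamp T (T - t))).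
Proof.
move=> eq_y; have [uu [M uM]] := energy_class_curve.
have [C wc] := energy_class_weak_curves.
have [A A0 aA] := Linfty_bound aL.
exists (fun t => G (T - t)), C, M.
apply: (reverse_solution siB (u := fun t => u (clamp T t)) (g := G)
  (potential_bounded aL A0 aA) uu uM energy_class_gradient wc).
move=> v h vh s t s0 st tT.
have t0 := le_trans s0 st; have sT := le_trans st tT.
have sT' : 0 <= s <= T by rewrite s0.
have tT' : 0 <= t <= T by rewrite t0.
have := eq_y _ _ vh t; have := eq_y _ _ vh s.
rewrite !in_itv/= s0 sT t0 tT => /(_ isT) eqs /(_ isT) eqt.
have [fi _] := fluxE h s0 (lexx T); have [_ fe] := fluxE h s0 tT.
have [si _] := sourceE v s0 sT (lexx T); have [_ se] := sourceE v s0 st tT.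
rewrite -fe -se; move: eqs eqt.
rewrite -/(source v) -/(flux h) (Rintegral_oo_split fi st tT).
rewrite (Rintegral_oo_split si st tT) (clamp_id sT') (clamp_id tT').
rewrite {1 2}/L2form /u (val_toL2 (yL2 sT')) (val_toL2 (yL2 tT')).
set i1 := \int[mu]_(r in `]t, T[) _; set i2 := \int[mu]_(r in `]t, T[) _.
set i3 := \int[mu]_(r in `]s, t[) _; set i4 := \int[mu]_(r in `]s, t[) _.
rewrite (addrC i3) (addrC i4) => h1 h2; exact: cancel_integrals h2 h1.
Qed.

End conversion.

(** * Flows and observation costs *)

Section segint_algebra.
Context {R : realType}.
Local Notation mu := (@lebesgue_measure R).
Implicit Types (f g : R -> R).

Lemma segintD f g a b : continuous f -> continuous g ->
  segint a b (fun x => f x + g x) = segint a b f + segint a b g.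
Proof.
by move=> cf cg; rewrite unlock (RintegralD _ (continuous_integrable a b cf)
  (continuous_integrable a b cg)).
Qed.

Lemma segintZ f c a b : continuous f ->
  segint a b (fun x => c * f x) = c * segint a b f.
Proof.
by move=> cf; rewrite unlock (RintegralZl c _ (continuous_integrable a b cf)).
Qed.

Lemma segint_sub_le f g a b e : continuous f -> continuous g -> a <= b ->
  (forall x, a <= x <= b -> `|f x - g x| <= e) ->
  `|segint a b f - segint a b g| <= (b - a) * e.
Proof.
move=> cf cg ab fge.
have cfg : continuous (fun x => f x - g x).
  by move=> x; apply: continuousB; [exact: cf|exact: cg].
have -> : segint a b f - segint a b g = segint a b (fun x => f x - g x).
  by rewrite unlock (RintegralB _ (continuous_integrable a b cf)
    (continuous_integrable a b cg)).
have := @integral_sub_const R (fun x => f x - g x) a b 0 e cfg ab.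
by rewrite mulr0 subr0; apply=> x xab; rewrite subr0 fge.
Qed.

Lemma segint_cst a b (c : R) : a <= b -> segint a b (fun=> c) = (b - a) * c.
Proof.
move=> ab; have c0 x : a <= x <= b -> `|c - c| <= 0 by rewrite subrr normr0.
have := integral_sub_const (fun x => @cst_continuous _ _ c x) ab c0.
by rewrite mulr0 normr_le0 subr_eq0 => /eqP.
Qed.

Lemma segint_le f g a b : continuous f -> continuous g ->
  (forall x, a <= x <= b -> f x <= g x) -> segint a b f <= segint a b g.
Proof.
move=> cf cg fg; rewrite unlock.
by apply: (le_Rintegral _ (continuous_integrable a b cf) (continuous_integrable a b cg)).
Qed.

Lemma segint_ge0 f a b : (forall x, a <= x <= b -> 0 <= f x) -> 0 <= segint a b f.
Proof.
by move=> f0; rewrite unlock; apply: Rintegral_ge0 => x /=; rewrite in_itv/= => /f0.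
Qed.

End segint_algebra.

Section flows.
Context {R : realType} {E : lmodType R} (B : E -> E -> R).
Hypothesis siB : semi_inner B.
Local Notation nrm := (fnorm B).
Variables (n : nat) (W : E -> ('I_n -> E) -> Prop).
Variable p : E -> R.
Hypothesis p_ge0 : forall x, 0 <= p x.
Hypothesis pZ : forall c x, p (c *: x) = `|c| * p x.
Hypothesis pD : forall x y, p (x + y) <= p x + p y.
Hypothesis p_le : forall x, p x <= nrm x.
Implicit Types (f h z : E).

Let p_dist x y : `|p x - p y| <= nrm (x - y).
Proof.
have le_sub x' y' : p x' - p y' <= nrm (x' - y').
  rewrite lerBlDr; apply: (@le_trans _ _ (p (x' - y') + p y')).
    by rewrite -{1}(subrK y' x').
  by rewrite lerD2r.
by rewrite ler_norml le_sub andbT lerNl opprB (fnormBC siB).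
Qed.

Let form_eq x x' z : nrm (x - x') = 0 -> B x z = B x' z.
Proof.
move=> xx'; apply/eqP; rewrite -subr_eq0 -(formBl siB) -normr_le0.
by rewrite (le_trans (form_le siB _ _))// xx' mul0r.
Qed.

Let nrm_eq x x' : nrm (x - x') = 0 -> nrm x = nrm x'.
Proof.
move=> xx'; apply/eqP; rewrite -subr_eq0 -normr_le0.
by rewrite (le_trans (ler_dist_fnorm siB _ _))// xx'.
Qed.

(** The datum is attained up to seminorm zero, that is, as an element of L^2. *)
Definition flow (a : E -> E) (T : R) (S : E -> R -> E) :=
  forall f, weak_solution B W a T (S f) /\ nrm (S f 0 - f) = 0.

Section one_flow.
Variables (a : E -> E) (A T : R) (S : E -> R -> E) (m : nat).
Hypothesis A0 : 0 <= A.
Hypothesis aA : bounded_form_op B A a.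
Hypothesis T0 : 0 <= T.
Hypothesis mT : 4 * A * T <= m.+1%:R.
Hypothesis flowS : flow a T S.
Let Cm : R := 2 ^+ m.+1.

(** The energy bound has the factor Cm on squared norms; as Cm >= 1, its square root is at most
    Cm. *)
Lemma sol_bound u : weak_solution B W a T u ->
  forall t, 0 <= t <= T -> nrm (u t) <= Cm * nrm (u 0).
Proof.
move=> usol t tT.
have C1 : 1 <= Cm by rewrite /Cm exprn_ege1// ler1n.
have C0 : 0 <= Cm by rewrite (le_trans ler01).
rewrite -(ler_pXn2r (n := 2))// ?nnegrE ?mulr_ge0 ?fnorm_ge0//.
rewrite (le_trans (energy_bound siB A0 aA usol mT tT))// exprMn.
by rewrite ler_wpM2r ?sqr_ge0// -/Cm expr2 ler_peMl.
Qed.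

Lemma flow_bound f t : 0 <= t <= T -> nrm (S f t) <= Cm * nrm f.
Proof.
by move=> tT; rewrite -(nrm_eq (flowS f).2); exact: sol_bound (flowS f).1 t tT.
Qed.

(** Transport with kappa = 0 along the line from (0, t) to (t, 0). *)
Lemma flow_dual f z t : 0 <= t <= T -> B (S f t) z = B f (S z t).
Proof.
move=> /andP[t0 tT].
have zero x y : `|B (a x) y - B (a x) y| <= 0 * nrm x * nrm y.
  by rewrite subrr normr0 !mul0r.
have bf := @flow_bound f; have bz := @flow_bound z.
have := transport_sol siB A0 A0 aA aA (flowS f).1 (flowS z).1 zero (lexx _) bf bz
  (lexx 0) t0.
rewrite add0r => /(_ t tT (lexx t) tT).
rewrite subrr !mul0r mulr0 normr_le0 subr_eq0 => /eqP.
rewrite (form_eq _ (flowS f).2) (formC siB _ (S z 0)) (form_eq _ (flowS z).2).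
by rewrite (formC siB z).
Qed.

(** Duality moves the flow onto the test vector z, leaving data on which the form is linear.
    Linearity thus holds up to seminorm zero. *)
Lemma flow_lin c f h t : 0 <= t <= T ->
  nrm (S (c *: f + h) t - (c *: S f t + S h t)) = 0.
Proof.
move=> tT; apply/eqP; rewrite eq_le fnorm_ge0 andbT.
apply: (fnorm_le siB) => // z; rewrite mul0r normr_le0.
rewrite (formBl siB) (form_lin siB) !flow_dual// (form_lin siB).
by rewrite subrr.
Qed.

Lemma continuous_seminorm_sol u : weak_solution B W a T u ->
  continuous (fun t => p (u t)).
Proof.
move=> [g [C [M us]]] t; apply/cvgrPdist_le => /= e e0.
have [eta eta0 he] := wsol_unif us e0.
near=> t'.
have tt' : `|t - t'| <= eta by near: t'; apply: (@cvgr_dist_le _ _ _ _ _ id).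
by rewrite (le_trans (p_dist _ _))// he.
Unshelve. all: by end_near. Qed.

Definition cost (T' : R) (S' : E -> R -> E) f := segint 0 T' (fun t => p (S' f t)).

Lemma cost_ge0 f : 0 <= cost T S f.
Proof. by apply: segint_ge0. Qed.

Let cS f := continuous_seminorm_sol (flowS f).1.

Let p_eq x x' : nrm (x - x') = 0 -> p x = p x'.
Proof.
move=> xx'; apply/eqP; rewrite -subr_eq0 -normr_le0.
by rewrite (le_trans (p_dist _ _))// xx'.
Qed.

Lemma costZ c f : cost T S (c *: f) = `|c| * cost T S f.
Proof.
rewrite /cost -segintZ; last exact: cS.
apply: eq_segint => t tT.
(* [flow_lin] applies to c f written as c f + 0; the extra term S 0 t has norm zero by the energy
   bound. *)
have S0 : p (S 0 t) = 0.
  apply/eqP; rewrite eq_le p_ge0 andbT (le_trans (p_le _))//.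
  by have := @flow_bound 0 t tT; rewrite (fnorm0 siB) mulr0.
rewrite -[c *: f]addr0 (p_eq (flow_lin _ _ _ tT)).
apply/eqP; rewrite eq_le; apply/andP; split.
  by rewrite (le_trans (pD _ _))// S0 addr0 pZ.
rewrite -pZ -[X in p X <= _](addrK (S 0 t)) (le_trans (pD _ _))//.
by rewrite -scaleN1r pZ S0 mulr0 addr0.
Qed.

Lemma costD f h : cost T S (f + h) <= cost T S f + cost T S h.
Proof.
rewrite /cost -segintD; [|exact: cS|exact: cS].
apply: segint_le; first exact: cS.
  by move=> x; apply: continuousD; exact: cS.
move=> t tT; have := flow_lin 1 f h tT; rewrite !scale1r => /p_eq ->.
exact: pD.
Qed.

Lemma cost_le f : cost T S f <= T * Cm * nrm f.
Proof.
apply: (@le_trans _ _ (segint 0 T (fun=> Cm * nrm f))).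
  apply: segint_le; first exact: cS.
    by move=> x; exact: cst_continuous.
  by move=> t tT; rewrite (le_trans (p_le _))// flow_bound.
by rewrite segint_cst// subr0 mulrA.
Qed.

End one_flow.

Section two_flows.
Variables (a a' : E -> E) (A T T' T2 kappa : R) (S S' : E -> R -> E) (m : nat).
Hypothesis A0 : 0 <= A.
Hypothesis aA : bounded_form_op B A a.
Hypothesis a'A : bounded_form_op B A a'.
Hypothesis T0 : 0 <= T <= T2.
Hypothesis T'0 : 0 <= T' <= T2.
Hypothesis mT : 4 * A * T2 <= m.+1%:R.
Hypothesis flowS : flow a T S.
Hypothesis flowS' : flow a' T' S'.
Hypothesis kappa0 : 0 <= kappa.
Hypothesis aa' : forall x y,
  `|B (a x) y - B (a' x) y| <= kappa * nrm x * nrm y.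
Let Cm : R := 2 ^+ m.+1.

Let le_mT t : 0 <= t <= T2 -> 4 * A * t <= m.+1%:R.
Proof.
by move=> /andP[_ t2]; rewrite (le_trans _ mT)// ler_wpM2l// mulr_ge0.
Qed.

(** Transport along the line from (0, t) to (t, 0) for S f and S' z; duality for S' then exposes the
    difference of the flows paired with an arbitrary z. *)
Lemma flow_compare f t : 0 <= t <= T -> t <= T' ->
  nrm (S f t - S' f t) <= T2 * (kappa * Cm * Cm) * nrm f.
Proof.
move=> /andP[t0 tT] tT'.
have C0 : 0 <= Cm by rewrite exprn_ge0.
have T20 : 0 <= T2 by case/andP: T0 => h1; exact: le_trans.
apply: (fnorm_le siB) => [|z]; first by rewrite !mulr_ge0 ?fnorm_ge0.
have bf r (h : 0 <= r <= T) := flow_bound A0 aA (le_mT T0) flowS f h.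
have bz r (h : 0 <= r <= T') := flow_bound A0 a'A (le_mT T'0) flowS' z h.
have := transport_sol siB A0 A0 aA a'A (flowS f).1 (flowS' z).1 aa' kappa0 bf bz
  (lexx 0) t0.
rewrite add0r => /(_ t tT (lexx t) tT').
rewrite subrr (form_eq _ (flowS f).2) (formC siB _ (S' z 0)) (form_eq _ (flowS' z).2).
rewrite (formC siB z) -(flow_dual A0 a'A (le_mT T'0) flowS') ?t0//.
rewrite -(formBl siB) => h; apply: (le_trans h).
have t2 : t <= T2 by case/andP: T0 => _; exact: le_trans.
have -> : T2 * (kappa * Cm * Cm) * nrm f * nrm z =
  T2 * (kappa * (Cm * nrm f) * (Cm * nrm z)) by ring.
by rewrite ler_wpM2r// !mulr_ge0 ?fnorm_ge0.
Qed.

(** The flows are compared up to the smaller final time k; the remaining piece has length at most |T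
    - T'| and is bounded by the energy estimate. *)
Lemma cost_compare f : `|cost T' S' f - cost T S f| <=
  (T2 * (T2 * (kappa * Cm * Cm)) + `|T - T'| * Cm) * nrm f.
Proof.
have C0 : 0 <= Cm by rewrite exprn_ge0.
have /andP[T00 T2T] := T0; have /andP[T'00 T2T'] := T'0.
have T20 : 0 <= T2 by exact: le_trans T2T.
have cS := continuous_seminorm_sol (flowS f).1.
have cS' := continuous_seminorm_sol (flowS' f).1.
pose k := Num.min T T'.
have k0 : 0 <= k by rewrite le_min T00.
have kT : k <= T by rewrite ge_min lexx.
have kT' : k <= T' by rewrite ge_min lexx orbT.
have k2 : k <= T2 by rewrite (le_trans kT).
rewrite /cost (integral_chasles cS k0 kT) (integral_chasles cS' k0 kT').
have main : `|segint 0 k (fun t => p (S' f t)) - segint 0 k (fun t => p (S f t))|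
    <= T2 * (T2 * (kappa * Cm * Cm)) * nrm f.
  apply: (@le_trans _ _ ((k - 0) * (T2 * (kappa * Cm * Cm) * nrm f))).
    apply: segint_sub_le => // t /andP[t0 tk].
    rewrite distrC (le_trans (p_dist _ _))// flow_compare ?t0 ?(le_trans tk)//.
  by rewrite subr0 -[leRHS]mulrA ler_wpM2r// !mulr_ge0 ?fnorm_ge0.
have tail : 0 <= segint k T (fun t => p (S f t)) <= (T - k) * (Cm * nrm f).
  rewrite segint_ge0//= -segint_cst//; apply: segint_le => //.
    by move=> x; exact: cst_continuous.
  move=> t /andP[kt tT]; rewrite (le_trans (p_le _))//.
  by rewrite (flow_bound A0 aA (le_mT T0) flowS)// (le_trans k0).
have tail' : 0 <= segint k T' (fun t => p (S' f t)) <= (T' - k) * (Cm * nrm f).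
  rewrite segint_ge0//= -segint_cst//; apply: segint_le => //.
    by move=> x; exact: cst_continuous.
  move=> t /andP[kt tT]; rewrite (le_trans (p_le _))//.
  by rewrite (flow_bound A0 a'A (le_mT T'0) flowS')// (le_trans k0).
have gap : (T - k) * (Cm * nrm f) <= `|T - T'| * (Cm * nrm f) /\
    (T' - k) * (Cm * nrm f) <= `|T - T'| * (Cm * nrm f).
  have h : T - k <= `|T - T'| /\ T' - k <= `|T - T'|.
    rewrite /k; case: (leP T T') => h; rewrite ?subrr ?normr_ge0; split=> //.
      by rewrite distrC ler_norm.
    by rewrite ler_norm.
  by split; rewrite ler_wpM2r ?mulr_ge0 ?fnorm_ge0//; case: h.
move: main tail tail' gap.
set i1 := segint 0 k _; set i2 := segint 0 k _.
set i3 := segint k T _; set i4 := segint k T' _.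
move=> main /andP[h1 h2] /andP[h3 h4] [h5 h6]; move: main.
by rewrite !ler_norml => /andP[h7 h8]; apply/andP; split; lra.
Qed.

(** Transport from (0, T) to (T, 0) of a solution u against the flow: up to the difference of
    potentials, observing S f T from u(0) is the same as observing f from u(T). *)
Lemma flow_observation u f : weak_solution B W a' T2 u ->
  `|B (u 0) (S f T) - B (u T) f| <= T2 * (kappa * Cm * Cm) * nrm (u 0) * nrm f.
Proof.
move=> usol.
have C0 : 0 <= Cm by rewrite exprn_ge0.
have /andP[T00 T2T] := T0; have T20 : 0 <= T2 by exact: le_trans T2T.
have bf r (h : 0 <= r <= T) := flow_bound A0 aA (le_mT T0) flowS f h.
have bu := sol_bound A0 a'A mT usol.
have a'a x y : `|B (a' x) y - B (a x) y| <= kappa * nrm x * nrm y.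
  by rewrite distrC.
have := transport_sol siB A0 A0 a'A aA usol (flowS f).1 a'a kappa0 bu bf
  (lexx 0) T00.
rewrite add0r => /(_ T T2T (lexx T) (lexx T)).
rewrite subrr (formC siB _ (S f 0)) (form_eq _ (flowS f).2) (formC siB f) distrC.
move=> h; apply: (le_trans h).
have -> : T2 * (kappa * Cm * Cm) * nrm (u 0) * nrm f =
  T2 * (kappa * (Cm * nrm (u 0)) * (Cm * nrm f)) by ring.
by rewrite ler_wpM2r// !mulr_ge0 ?fnorm_ge0.
Qed.

End two_flows.
End flows.

(** * The backward equation as a flow in reversed time *)

Section backward_flow.
Context {R : realType} {N : nat}.
Local Notation V := 'rV[R]_N.
Variables (D : set V) (a : V -> R) (T : R) (Phi : (V -> R) -> R -> V -> R).
Local Notation B := (@L2form R N D).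
Hypothesis aL : Linfty D a.
Hypothesis T0 : 0 < T.
Hypothesis Phi_sol : forall psi, L2 D psi -> backward_solution D a T psi (Phi psi).

Definition reversed_flow (f : L2space D) (t : R) :=
  toL2 D (Phi (val f) (clamp T (T - t))).

Lemma backward_solution_L2 psi t : L2 D psi -> 0 <= t <= T -> L2 D (Phi psi t).
Proof.
by move=> /Phi_sol[g [[h _ _ _ _] _ _]] tT; apply: h; rewrite in_itv.
Qed.

Lemma backward_flow : flow B (@H10_rel R N D) (potential a) T reversed_flow.
Proof.
move=> f; have fL := L2_val f; have [g [yE PhiT eq_Phi]] := Phi_sol fL.
split; first exact: (backward_weak_solution T0 yE aL eq_Phi).
have TT : 0 <= T <= T by rewrite lexx ltW.
rewrite /reversed_flow subr0 clamp_id// -[X in _ - X](_ : toL2 D (val f) = f).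
  by rewrite -normL2_sub//; exact: backward_solution_L2.
by apply: val_inj; rewrite val_toL2.
Qed.

Variables (omega : set V) (K : R) (y0 : V -> R).
Hypothesis y0L : L2 D y0.
Let p (f : L2space D) := normL2 omega (val f).
Hypothesis p_cont : forall u, weak_solution B (@H10_rel R N D) (potential a) T u ->
  continuous (fun t => p (u t)).

Lemma J_reversed_flow f : J D omega K y0 T Phi (val f) =
  2^-1 * cost p T reversed_flow f ^+ 2 + B (toL2 D y0) (reversed_flow f T) +
  K * fnorm B f.
Proof.
have clampt t : 0 <= t <= T -> clamp T (T - (T - t)) = t.
  by move=> tT; rewrite opprB addrC subrK clamp_id.
have PhiL t : 0 <= t <= T -> L2 D (Phi (val f) t).
  by apply: backward_solution_L2; exact: L2_val.
rewrite /J -fnorm_L2form; congr (2^-1 * _ ^+ 2 + _ + _).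
  have cp := p_cont (backward_flow f).1.
  have := integral_reflect 0 T T cp; rewrite subrr subr0 -/(cost p T reversed_flow f) => <-.
  rewrite [in RHS]unlock; apply: eq_Rintegral => t; rewrite inE/= in_itv/= => tT.
  by rewrite /p /reversed_flow clampt// val_toL2// PhiL.
have T00 : 0 <= (0 : R) <= T by apply/andP; split; rewrite ?lexx ?ltW.
by rewrite /reversed_flow subrr clamp_id// -innerL2_toL2// PhiL.
Qed.

End backward_flow.

(** * Convergence of the minimizers as the perturbation vanishes *)

Unset Implicit Arguments.
Set Strict Implicit.

Theorem theorem2p1 (R : realType) (N : nat) (Omega omega : set 'rV[R]_N)
    (K T delta eps0 : R) (y0 a : 'rV[R]_N -> R)
    (Teps : R -> R) (aeps : R -> 'rV[R]_N -> R)
    (y : R -> 'rV[R]_N -> R)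
    (phi : ('rV[R]_N -> R) -> R -> 'rV[R]_N -> R)
    (phieps : R -> ('rV[R]_N -> R) -> R -> 'rV[R]_N -> R)
    (hatphi : 'rV[R]_N -> R) (hatphieps : R -> 'rV[R]_N -> R)
    (N_gt0 : (0 < N)%N)
    (Omega_dom : smooth_bounded_domain Omega)
    (omega_open : open omega) (omega_neq0 : omega !=set0)
    (omega_sub : omega `<=` Omega)
    (K_gt0 : 0 < K) (y0_L2 : L2 Omega y0) (T_gt0 : 0 < T)
    (a_Linfty : Linfty Omega a)
    (delta_itv : 0 < delta < T) (eps0_gt0 : 0 < eps0)
    (Teps_gt0 : forall e, 0 < e <= eps0 -> 0 < Teps e)
    (aeps_Linfty : forall e, 0 < e <= eps0 -> Linfty Omega (aeps e))
    (y_sol : forall S, 0 < S -> forward_solution Omega a S y0 y)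
    (phi_sol : forall phiT, L2 Omega phiT ->
       backward_solution Omega a T phiT (phi phiT))
    (phieps_sol : forall e, 0 < e <= eps0 -> forall psi, L2 Omega psi ->
       backward_solution Omega (aeps e) (Teps e) psi (phieps e psi))
    (aeps_cvg : normLinfty Omega (aeps e \- a) @[e --> 0^'+] --> 0%E)
    (Teps_cvg : `|Teps e - T| @[e --> 0^'+] --> (0 : R))
    (yT_gt : K < normL2 Omega (y T))
    (Teps_near : forall e, 0 < e <= eps0 -> `|T - Teps e| <= delta)
    (hatphi_min : unique_minimizer Omega (J Omega omega K y0 T phi) hatphi)
    (hatphieps_min : forall e, 0 < e <= eps0 ->
       unique_minimizer Omega (J Omega omega K y0 (Teps e) (phieps e))
         (hatphieps e))
    (hatphieps_neq0 : forall e, 0 < e <= eps0 ->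
       normL2 Omega (hatphieps e) != 0) :
  normL2 Omega (hatphieps e \- hatphi) @[e --> 0^'+] --> (0 : R).
Proof.
pose E := L2space Omega; pose B := @L2form R N Omega.
pose W := @H10_rel R N Omega.
have siB : semi_inner B := L2form_semi_inner Omega.
have mo : measurable (omega : set 'rV[R]_N) := open_measurable_rV omega_open.
have siO := subform_semi_inner mo omega_sub.
pose p (f : E) := normL2 omega (val f).
have pE f : p f = fnorm (fun f g : E => innerL2 omega (val f) (val g)) f.
  by rewrite /p normL2E.
have p_ge0 f : 0 <= p f by rewrite pE fnorm_ge0.
have pZ c f : p (c *: f) = `|c| * p f by rewrite !pE (fnormZ siO).
have pD f g : p (f + g) <= p f + p g by rewrite !pE (fnormD siO).
have p_le f : p f <= fnorm B f.
  by rewrite fnorm_L2form; exact: (L2_subdomain mo omega_sub (L2_val f)).2.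
have [A A0 aA] := Linfty_bound a_Linfty.
(* For small e the potential [aeps e] is within 1 of [a] in L^oo, so A + 1 serves for both. *)
pose A1 := A + 1; have A10 : 0 <= A1 by rewrite addr_ge0.
have opa : bounded_form_op B A1 (potential a).
  apply: potential_bounded => //; apply: (le_trans aA).
  by rewrite lee_fin lerDl.
(* A common horizon: [Teps e] <= T + delta < 2 T, so one growth constant [Cm] serves all flows. *)
pose T2 := 2 * T; have T20 : 0 < T2 by rewrite mulr_gt0.
have T2_near x : `|T - x| <= delta -> x <= T2.
  move: delta_itv => /andP[_ dT]; rewrite ler_norml => /andP[dx _].
  by move: dT dx; rewrite /T2; clear; ilra.
have TT2 : 0 <= T <= T2 by rewrite (ltW T_gt0) /T2; lra.
pose m := Num.truncn (4 * A1 * T2).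
have mT : 4 * A1 * T2 <= m.+1%:R by rewrite ltW// truncnS_gt.
pose Cm : R := 2 ^+ m.+1; have Cm0 : 0 <= Cm by rewrite exprn_ge0.
have mT1 : 4 * A1 * T <= m.+1%:R.
  by rewrite (le_trans _ mT)// ler_wpM2l ?mulr_ge0//; case/andP: TT2.
(* The trajectory is followed up to T2, which covers both times T and [Teps e]. *)
pose Y t := toL2 Omega (y (clamp T2 t)).
have [gy [yE y_0 eq_y]] := y_sol _ T20.
have Ysol : weak_solution B W (potential a) T2 Y.
  exact: (forward_weak_solution T20 yE a_Linfty eq_y).
have yL t : 0 <= t <= T2 -> L2 Omega (y t).
  by have [h _ _ _ _] := yE; move=> tT; apply: h; rewrite in_itv.
pose Y0 := toL2 Omega y0.
have T200 : 0 <= (0 : R) <= T2 by apply/andP; split; rewrite ?lexx ?ltW.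
have Y0E f : B Y0 f = B (Y 0) f.
  apply/eqP; rewrite eq_sym -subr_eq0 -(formBl siB) -normr_le0.
  rewrite (le_trans (form_le siB _ _))// /Y clamp_id// -normL2_sub ?yL//.
  by rewrite y_0 mul0r.
pose S := reversed_flow (D := Omega) T phi.
have flowS : flow B W (potential a) T S := backward_flow a_Linfty T_gt0 phi_sol.
have cont a' T' u : weak_solution B W a' T' u -> continuous (fun t => p (u t)).
  exact: (continuous_seminorm_sol siB pD p_le).
(* Duality with kappa = 0 turns <y0, phi(0)> into <y(T), f>, the linear part whose norm exceeds
   K. *)
have JE f : J Omega omega K y0 T phi (val f) =
    2^-1 * cost p T S f ^+ 2 + B (Y T) f + K * fnorm B f.
  transitivity (2^-1 * cost p T S f ^+ 2 + B Y0 (S f T) + K * fnorm B f).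
    exact: (J_reversed_flow a_Linfty T_gt0 phi_sol K y0_L2 (cont _ _)).
  congr (_ + _ + _); rewrite Y0E; apply/eqP; rewrite -subr_eq0 -normr_le0.
  have zero x z : `|B (potential a x) z - B (potential a x) z| <= 0 * fnorm B x * fnorm B z.
    by rewrite subrr normr0 !mul0r.
  have := flow_observation siB A10 opa opa TT2 mT flowS (lexx 0) zero f Ysol.
  by rewrite !mul0r mulr0 !mul0r.
pose P := toL2 Omega hatphi.
have [[hatL hatmin] _] := hatphi_min.
have YT : fnorm B (Y T) = normL2 Omega (y T).
  by rewrite /Y clamp_id// -normL2_toL2// yL.
have near_min := perturbed_minimizer_near siB (N := cost p T S) (C := T * Cm)
  (K := K) (f := Y T) (p := P).
have {}near_min := near_min (cost_ge0 p_ge0 T S)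
  (costZ siB p_ge0 pZ pD p_le A10 opa mT1 flowS)
  (costD siB pD p_le A10 opa mT1 flowS)
  (cost_le siB pD p_le A10 opa (ltW T_gt0) mT1 flowS)
  (mulr_ge0 (ltW T_gt0) Cm0) K_gt0.
rewrite YT in near_min.
have {}near_min := near_min yT_gt.
have Pmin f : 2^-1 * cost p T S P ^+ 2 + B (Y T) P + K * fnorm B P <=
    2^-1 * cost p T S f ^+ 2 + B (Y T) f + K * fnorm B f.
  by rewrite -!JE val_toL2//; apply: hatmin; exact: L2_val.
have {}near_min := near_min Pmin.
apply/cvgrPdist_le => /= eta eta0.
have [d d0 hd] := near_min eta eta0.
(* The first summand is the coefficient of k in the error of the cost, the second that in the error
   of the linear part; the 1 makes X positive. *)
pose X := T2 * T2 * Cm * Cm + T2 * Cm * Cm * fnorm B (Y 0) + 1.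
have X0 : 0 < X by rewrite ltr_wpDl// addr_ge0// !mulr_ge0 ?fnorm_ge0// ltW.
pose k := Num.min 1 (d / (2 * X)).
have k0 : 0 < k by rewrite lt_min ltr01 divr_gt0// mulr_gt0.
have k1 : k <= 1 by rewrite ge_min lexx.
have kX : k * X <= d / 2.
  have : k <= d / (2 * X) by rewrite ge_min lexx orbT.
  by rewrite ler_pdivlMr ?mulr_gt0//; lra.
have [gY [CY [MY Yw]]] := Ysol.
have d2 : 0 < d / 2 by rewrite divr_gt0.
have [eta1 eta10 Yunif] := wsol_unif Yw d2.
(* The first bound serves the motion of [Y] between T and [Teps e], the second the part of the cost
   between these two times. *)
pose r := Num.min eta1 (d / 2 / (Cm + 1)).
have Cm1 : 0 < Cm + 1 by rewrite ltr_wpDl.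
have r0 : 0 < r by rewrite lt_min eta10 divr_gt0.
have near_a : \forall e \near 0^'+, (normLinfty Omega (aeps e \- a)%R <= k%:E)%E.
  have k0' : (0 < k%:E :> \bar R)%E by rewrite lte_fin.
  have : nbhs (0%E : \bar R) [set x | (x < k%:E)%E].
    by apply: open_nbhs_nbhs; split; [exact: open_ereal_lt_ereal|].
  move=> /aeps_cvg near_lt; near=> e.
  have : (normLinfty Omega (aeps e \- a)%R < k%:E)%E by near: e; exact: near_lt.
  exact: ltW.
have near_T : \forall e \near 0^'+, `|Teps e - T| <= r.
  have /cvgrPdist_le/(_ r r0) := Teps_cvg; apply: filterS => e /=.
  by rewrite sub0r normrN normr_id.
near=> e.
have e_itv : 0 < e <= eps0.
  apply/andP; split; near: e; [exact: nbhs_right_gt|exact: nbhs_right_le].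
have ae_k : (normLinfty Omega (aeps e \- a)%R <= k%:E)%E by near: e.
have Te_r : `|Teps e - T| <= r by near: e.
have aeL := aeps_Linfty e e_itv; have Te0 := Teps_gt0 e e_itv.
have kae x z : `|B (potential a x) z - B (potential (aeps e) x) z| <=
    k * fnorm B x * fnorm B z.
  by rewrite distrC; apply: potential_sub_le => //; exact: ltW.
have kea x z : `|B (potential (aeps e) x) z - B (potential a x) z| <=
    k * fnorm B x * fnorm B z by rewrite distrC.
(* Triangle inequality around [potential a]: the form bound is A + k <= A + 1. *)
have opae : bounded_form_op B A1 (potential (aeps e)).
  split=> x z; first by have [A' A'0 hA'] := Linfty_bound aeL;
    exact: (potential_bounded aeL A'0 hA').1.
  have h1 := (potential_bounded a_Linfty A0 aA).2 x z; have h2 := kea x z.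
  rewrite -(subrK (B (potential a x) z) (B (potential (aeps e) x) z)).
  rewrite (le_trans (ler_normD _ _))// addrC.
  apply: (le_trans (lerD h1 h2)).
  rewrite -!mulrDl -mulrA -[leRHS]mulrA ler_wpM2r ?mulr_ge0 ?fnorm_ge0//.
  by rewrite lerD2l.
have TeT2 : 0 <= Teps e <= T2.
  by rewrite (ltW Te0)/=; exact: T2_near (Teps_near e e_itv).
pose Se := reversed_flow (D := Omega) (Teps e) (phieps e).
have flowSe : flow B W (potential (aeps e)) (Teps e) Se :=
  backward_flow aeL Te0 (phieps_sol e e_itv).
have JeE f : J Omega omega K y0 (Teps e) (phieps e) (val f) =
    2^-1 * cost p (Teps e) Se f ^+ 2 + B Y0 (Se f (Teps e)) + K * fnorm B f.
  exact: (J_reversed_flow aeL Te0 (phieps_sol e e_itv) K y0_L2 (cont _ _)).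
have [[qL qmin] _] := hatphieps_min e e_itv.
rewrite sub0r normrN normL2_sub// ger0_norm ?fnorm_ge0//.
(* Stability is applied with the perturbed cost and linear part; its last condition holds because
   [hatphieps e] does at least as well as [hatphi] for the perturbed functional. *)
apply: (hd (cost p (Teps e) Se) (fun f => B Y0 (Se f (Teps e)))).
- exact: cost_ge0.
- move=> f; have cc := cost_compare siB p_ge0 pD p_le A10 opa opae TT2 TeT2 mT
    flowS flowSe (ltW k0) kae f.
  apply: (le_trans cc).
  rewrite ler_wpM2r ?fnorm_ge0//.
  have c1 : `|T - Teps e| * Cm <= d / 2.
    have : `|T - Teps e| <= d / 2 / (Cm + 1).
      by rewrite distrC (le_trans Te_r)// ge_min lexx orbT.
    rewrite ler_pdivlMr// mulrDr mulr1; apply: le_trans.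
    by rewrite lerDl.
  have c2 : T2 * (T2 * (k * Cm * Cm)) <= k * X.
    have -> : T2 * (T2 * (k * Cm * Cm)) = k * (T2 * T2 * Cm * Cm) by ring.
    rewrite ler_wpM2l ?(ltW k0)// /X -addrA lerDl.
    by rewrite addr_ge0// !mulr_ge0 ?fnorm_ge0// ltW.
  by rewrite [leRHS](splitr d); exact: (lerD (le_trans c2 kX) c1).
(* Two errors of size d / 2: the change of potential over (0, [Teps e]), and the motion of [Y] from
   T to [Teps e]. *)
- move=> f; rewrite Y0E.
  have h1 := flow_observation siB A10 opae opa TeT2 mT flowSe (ltW k0) kea f Ysol.
  have h2 : `|B (Y (Teps e)) f - B (Y T) f| <= d / 2 * fnorm B f.
    rewrite -(formBl siB) (le_trans (form_le siB _ _))// ler_wpM2r ?fnorm_ge0//.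
    by apply: Yunif; rewrite (le_trans Te_r)// ge_min lexx.
  have c2 : T2 * (k * Cm * Cm) * fnorm B (Y 0) <= k * X.
    have -> : T2 * (k * Cm * Cm) * fnorm B (Y 0) =
      k * (T2 * Cm * Cm * fnorm B (Y 0)) by ring.
    rewrite ler_wpM2l ?(ltW k0)// /X addrAC lerDr.
    by rewrite addr_ge0// !mulr_ge0 ?fnorm_ge0// ltW.
  have h3 := le_trans h1 (ler_wpM2r (fnorm_ge0 B f) (le_trans c2 kX)).
  rewrite -(subrKA (B (Y (Teps e)) f)) (le_trans (ler_normD _ _))//.
  have -> : d * fnorm B f = d / 2 * fnorm B f + d / 2 * fnorm B f by field.
  exact: lerD.
- by rewrite -!JeE (val_toL2 qL) (val_toL2 hatL); exact: qmin.
Unshelve. all: by end_near. Qed.
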